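(* Let $\{x_k,y_k\}_{k\ge0}$ be generated by $$x_{k+1}=x_k+\alpha_k\big(f(x_k,y_k)-x_k+M_{k+1}\big),\qquad y_{k+1}=y_k+\beta_k\big(g(x_k,y_k)-y_k+M'_{k+1}\big),$$ where $f,g,J$, the noise sequences and the step sizes satisfy all the standing assumptions (i)--(v) listed in the context. Then there exist constants $C_3,C_4>0$ (with $C_4$ not depending on the step-size parameters) such that if $\alpha\le C_4$, then for all $k\ge0$, $$\min_{0\le i\le k}\mathbb{E}\big[\|\nabla J(y_i)\|^2\big]\le\frac{C_3\,(1+\log(k+1))}{(1+k)^{1-\mathfrak b}}.$$
   Context: $\|\cdot\|$ is the Euclidean norm. Let $f:\mathbb{R}^{d_1}\times\mathbb{R}^{d_2}\to\mathbb{R}^{d_1}$ and $g:\mathbb{R}^{d_1}\times\mathbb{R}^{d_2}\to\mathbb{R}^{d_2}$. The initial points $x_0,y_0$ are deterministic. Standing assumptions: (i) (Contraction.) There is a constant $0\le\mu<1$ with $\|f(x_1,y)-f(x_2,y)\|\le\mu\|x_1-x_2\|$ for all $x_1,x_2\in\mathbb{R}^{d_1}$, $y\in\mathbb{R}^{d_2}$. For each $y$, $x^*(y)$ denotes the unique fixed point of $f(\cdot,y)$. (ii) (Gradient operator.) There is a differentiable function $J:\mathbb{R}^{d_2}\to\mathbb{R}$ with $g(x^*(y),y)-y=-\nabla J(y)$ for all $y$, and $J$ is bounded from below: there is $J_{\min}\in\mathbb{R}$ with $J(y)\ge J_{\min}$ for all $y$. ($J$ need not be convex.) (iii) (Lipschitz.)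 There is a constant $L>0$ such that both $\|f(x_1,y_1)-f(x_2,y_2)\|+\|g(x_1,y_1)-g(x_2,y_2)\|\le L(\|x_1-x_2\|+\|y_1-y_2\|)$ for all arguments and $\|G(x_1,y_1)-G(x_2,y_2)\|\le L(\|x_1-x_2\|+\|y_1-y_2\|)$, where $G(x,y)=g(x,y)-y$. (iv) (Noise.) With $\mathcal{F}_k=\sigma(x_0,y_0,M_i,M'_i,\ i\le k)$, the sequences $\{M_{k+1}\}\subset\mathbb{R}^{d_1}$, $\{M'_{k+1}\}\subset\mathbb{R}^{d_2}$ satisfy $\mathbb{E}[M_{k+1}\mid\mathcal{F}_k]=0$, $\mathbb{E}[M'_{k+1}\mid\mathcal{F}_k]=0$, and for some constant $\mathfrak{c}_2>0$, $\mathbb{E}[\|M_{k+1}\|^2+\|M'_{k+1}\|^2\mid\mathcal{F}_k]\le\mathfrak{c}_2$ for all $k\ge0$. (v) (Step sizes.) $\alpha_k=\alpha/(k+K_1)^{\mathfrak a}$ and $\beta_k=\beta/(k+K_1)^{\mathfrak b}$ with $\alpha,\beta>0$, $K_1\ge1$, $\mathfrak a<\mathfrak b<1$, $0.5<\mathfrak b$, and for all $k\ge0$: $\beta_k^2\le\alpha_k^3$ and $\beta_k\alpha_k\le\beta\alpha/(k+K_1)$. (Square-summability of $\alpha_k$ is not required.) The constants may depend on the problem data; $C_3$ may in addition depend on the step-size parameters and on $x_0,y_0$. *)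

(* Defs.v *)
From HB Require Import structures.
From mathcomp Require Import all_boot all_order all_algebra.
From mathcomp Require Import all_classical all_reals all_analysis.

Set Implicit Arguments.
Unset Strict Implicit.
Unset Printing Implicit Defensive.

Import Order.TTheory GRing.Theory Num.Theory.
Import numFieldNormedType.Exports.

Local Open Scope classical_set_scope.
Local Open Scope ring_scope.

(* The library norm `|v| on 'rV[R]_n is the sup norm, hence this definition. *)
Definition enorm (R : realType) (n : nat) (v : 'rV[R]_n) : R :=
  Num.sqrt (\sum_(j < n) v 0 j ^+ 2).

Definition grad (R : realType) (n : nat) (J : 'rV[R]_n -> R) (y : 'rV[R]_n) :
    'rV[R]_n :=
  \row_(j < n) 'D_(delta_mx 0 j) J y.

(* x^*(y).  [get] is a choice operator with a junk default; when f(., y) is a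
   contraction for the Euclidean norm there is exactly one fixed point, and
   [get] returns it. *)
Definition fixpt (R : realType) (d1 d2 : nat)
    (f : 'rV[R]_d1 -> 'rV[R]_d2 -> 'rV[R]_d1) (y : 'rV[R]_d2) : 'rV[R]_d1 :=
  get [set x | f x y = x].

Definition stepsize (R : realType) (c K1 e : R) (k : nat) : R :=
  c / (k%:R + K1) `^ e.

(* The events {X_j \in B}, B Borel in R, j a coordinate: they generate
   sigma(X), because the Borel sigma-algebra of R^n is generated by the
   coordinate projections. *)
Definition coord_events (R : realType) (T : Type) (n : nat)
    (X : T -> 'rV[R]_n) : set (set T) :=
  [set A | exists (j : 'I_n) (B : set R),
     measurable B /\ A = (fun w => X w 0 j) @^-1` B].

(* sigma(x_0, y_0, M_i, M'_i, i <= k).  The noise sequences start at index 1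
   (M 0 and M' 0 are never used), and the initial points are deterministic, so
   they contribute nothing to the sigma-algebra. *)
Definition noise_filtration (R : realType) (T : Type) (d1 d2 : nat)
    (M : nat -> T -> 'rV[R]_d1) (M' : nat -> T -> 'rV[R]_d2) (k : nat) :
    set (set T) :=
  <<s [set A | exists i : nat, (0 < i <= k)%N /\
         (coord_events (M i) A \/ coord_events (M' i) A)] >>.

(* Y is a version of E[X | F] *)
Definition is_cond_exp (R : realType) (d : measure_display)
    (T : measurableType d) (P : probability T R) (F : set (set T))
    (X Y : T -> R) : Prop :=
  [/\ P.-integrable setT (EFin \o X),
      P.-integrable setT (EFin \o Y),
      (forall B : set R, measurable B -> F (Y @^-1` B)) &
      forall A : set T, F A ->
        (\int[P]_(w in A) (Y w)%:E = \int[P]_(w in A) (X w)%:E)%E].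

(* E[X | F] = 0 for a random vector X *)
Definition cond_centered (R : realType) (d : measure_display)
    (T : measurableType d) (P : probability T R) (F : set (set T)) (n : nat)
    (X : T -> 'rV[R]_n) : Prop :=
  forall j : 'I_n, is_cond_exp P F (fun w => X w 0 j) (fun=> 0).

(* E[X | F] <= c almost surely *)
Definition cond_exp_le (R : realType) (d : measure_display)
    (T : measurableType d) (P : probability T R) (F : set (set T))
    (X : T -> R) (c : R) : Prop :=
  exists Y : T -> R, is_cond_exp P F X Y /\ {ae P, forall w, Y w <= c}.

(* Main.v *)
Require Import Defs.
From HB Require Import structures.
From mathcomp Require Import all_boot all_order all_algebra.
From mathcomp Require Import all_classical all_reals all_analysis.
From mathcomp Require Import measurable_realfun.
From mathcomp Require Import ring lra.

Set Implicit Arguments.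
Unset Strict Implicit.
Unset Printing Implicit Defensive.

Import Order.TTheory GRing.Theory Num.Theory.
Import numFieldNormedType.Exports.

Local Open Scope classical_set_scope.
Local Open Scope ring_scope.

(** With z = x - x^*(y), the potential J(y_k) + kap (beta_k / alpha_k) |z_k|^2
    decreases in conditional mean by (beta_k / 4) |grad J(y_k)|^2 up to an error
    O(alpha_k beta_k).  The descent of J costs O(beta_k |z_k|^2) because the
    iterate uses G(x, y) instead of - grad J(y) = G(x^*(y), y); the contraction
    of the fast iterate gains c alpha_k |z_k|^2 with c = 1 - mu, which
    scaled by kap beta_k / alpha_k is kap c beta_k |z_k|^2 and absorbs that cost.
    The drift of x^*(y_k) contributes (beta_k^3 / alpha_k^2) |G + M'|^2, which
    is O(alpha_k beta_k) as beta_k^2 <= alpha_k^3, and beta_k / alpha_k is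
    nonincreasing, so the potentials telescope.  Summation gives
    sum beta_i E|grad J(y_i)|^2 = O(sum alpha_i beta_i) = O(1 + log(k + 1)),
    while sum beta_i is at least of order (k + 1)^(1 - b). *)

(** * Inner product and Euclidean norm on row vectors *)

Section Euclidean.
Context {R : realType}.

Definition dotv (n : nat) (u v : 'rV[R]_n) : R := \sum_(j < n) u 0 j * v 0 j.

Section Dim.
Variable n : nat.
Implicit Types (u v w : 'rV[R]_n) (a : R).

Lemma dotvC u v : dotv u v = dotv v u.
Proof. by apply: eq_bigr => j _; rewrite mulrC. Qed.

Lemma dotvDr u v w : dotv u (v + w) = dotv u v + dotv u w.
Proof. by rewrite -big_split; apply: eq_bigr => j _; rewrite mxE mulrDr. Qed.

Lemma dotvZr a u v : dotv u (a *: v) = a * dotv u v.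
Proof. by rewrite mulr_sumr; apply: eq_bigr => j _; rewrite mxE mulrCA. Qed.

Lemma dotvDl u v w : dotv (u + v) w = dotv u w + dotv v w.
Proof. by rewrite dotvC dotvDr !(dotvC w). Qed.

Lemma dotvZl a u v : dotv (a *: u) v = a * dotv u v.
Proof. by rewrite dotvC dotvZr dotvC. Qed.

Lemma dotvNr u v : dotv u (- v) = - dotv u v.
Proof. by rewrite -scaleN1r dotvZr mulN1r. Qed.

Lemma dotvNl u v : dotv (- u) v = - dotv u v.
Proof. by rewrite dotvC dotvNr dotvC. Qed.

Lemma enorm_sqr u : enorm u ^+ 2 = dotv u u.
Proof.
rewrite sqr_sqrtr; first by apply: eq_bigr => j _; rewrite expr2.
by apply: sumr_ge0 => j _; exact: sqr_ge0.
Qed.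

Lemma enorm_ge0 u : 0 <= enorm u. Proof. exact: sqrtr_ge0. Qed.

Lemma enorm0 : enorm (0 : 'rV[R]_n) = 0.
Proof. by rewrite /enorm big1 ?sqrtr0// => j _; rewrite mxE expr0n. Qed.

Lemma enormZ a u : enorm (a *: u) = `|a| * enorm u.
Proof.
rewrite /enorm -sqrtr_sqr -sqrtrM ?sqr_ge0//; congr Num.sqrt.
by rewrite mulr_sumr; apply: eq_bigr => j _; rewrite mxE exprMn.
Qed.

Lemma enormN u : enorm (- u) = enorm u.
Proof. by rewrite -scaleN1r enormZ normrN1 mul1r. Qed.

Lemma enorm_sqrD u v :
  enorm (u + v) ^+ 2 = enorm u ^+ 2 + 2 * dotv u v + enorm v ^+ 2.
Proof. rewrite !enorm_sqr dotvDl !dotvDr (dotvC v u); ring. Qed.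

Lemma coord_le_enorm u (j : 'I_n) : `|u 0 j| <= enorm u.
Proof.
rewrite -sqrtr_sqr ler_sqrt; last by apply: sumr_ge0 => ? _; exact: sqr_ge0.
by rewrite (bigD1 j)//= lerDl; apply: sumr_ge0 => ? _; exact: sqr_ge0.
Qed.

Lemma enorm_eq0 u : enorm u = 0 -> u = 0.
Proof.
move=> u0; apply/rowP => j; rewrite mxE; apply/normr0_eq0/le_anti.
by rewrite normr_ge0 andbT -u0 coord_le_enorm.
Qed.

(** Expanding the square of [enorm v *: u - enorm u *: v] gives 2 |u| |v| (|u| |v| - u.v) >= 0. The
    cases of a zero norm are treated apart so that the positive factor can be cancelled. *)
Lemma cauchy_schwarz u v : dotv u v <= enorm u * enorm v.
Proof.
have [u0|uN0] := eqVneq (enorm u) 0.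
  rewrite u0 mul0r (enorm_eq0 u0) /dotv big1// => j _.
  by rewrite mxE mul0r.
have [v0|vN0] := eqVneq (enorm v) 0.
  rewrite v0 mulr0 (enorm_eq0 v0) /dotv big1// => j _.
  by rewrite mxE mulr0.
have up : 0 < enorm u by rewrite lt_def uN0 enorm_ge0.
have vp : 0 < enorm v by rewrite lt_def vN0 enorm_ge0.
have := sqr_ge0 (enorm (enorm v *: u - enorm u *: v)).
rewrite enorm_sqrD enormN !enormZ dotvNr dotvZl dotvZr.
rewrite !ger0_norm ?enorm_ge0//.
have -> : (enorm v * enorm u) ^+ 2 + 2 * - (enorm v * (enorm u * dotv u v)) +
  (enorm u * enorm v) ^+ 2 =
  2 * (enorm u * enorm v) * (enorm u * enorm v - dotv u v) by ring.
by rewrite pmulr_rge0 ?subr_ge0// !mulr_gt0.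
Qed.

Lemma normr_dotv u v : `|dotv u v| <= enorm u * enorm v.
Proof.
by rewrite ler_norml cauchy_schwarz andbT lerNl -dotvNl -(enormN u) cauchy_schwarz.
Qed.

Lemma enormD u v : enorm (u + v) <= enorm u + enorm v.
Proof.
rewrite -(ler_pXn2r (ltn0Sn 1)) ?nnegrE ?addr_ge0 ?enorm_ge0// enorm_sqrD.
by have := cauchy_schwarz u v; lra.
Qed.

Lemma enormB_trans w u v : enorm (u - v) <= enorm (u - w) + enorm (w - v).
Proof. by apply: le_trans (enormD _ _); rewrite addrA subrK. Qed.

Lemma enorm_le_sum u : enorm u <= \sum_(j < n) `|u 0 j|.
Proof.
have s0 : 0 <= \sum_(j < n) `|u 0 j| by exact: sumr_ge0.
rewrite -(ler_pXn2r (ltn0Sn 1)) ?nnegrE ?enorm_ge0// enorm_sqr /dotv.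
rewrite [leRHS]expr2 mulr_suml; apply: ler_sum => j _.
apply: le_trans (ler_norm _) _; rewrite normrM ler_wpM2l//.
by rewrite (bigD1 j)//= lerDl; exact: sumr_ge0.
Qed.

(** Young's inequality with a free parameter: [t] is c a in [tracking_step], where only a small loss
    on the first term is affordable, and 1 where constants do not matter. *)
Lemma enorm_sqrD_le t u v : 0 < t ->
  enorm (u + v) ^+ 2 <= (1 + t) * enorm u ^+ 2 + (1 + t^-1) * enorm v ^+ 2.
Proof.
move=> t0; rewrite enorm_sqrD.
have := cauchy_schwarz u v; set d := dotv u v.
have := enorm_ge0 u; have := enorm_ge0 v; set p := enorm u; set q := enorm v.
move=> q0 p0 h.
have : 0 <= t * (p - t^-1 * q) ^+ 2 by rewrite mulr_ge0 ?sqr_ge0 ?ltW.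
have -> : t * (p - t^-1 * q) ^+ 2 = t * p ^+ 2 - 2 * (p * q) + t^-1 * q ^+ 2.
  by field; rewrite gt_eqF.
lra.
Qed.

End Dim.
End Euclidean.

(** * Completeness, comparison with the sup norm, and fixed points of contractions *)

HB.instance Definition _ (R : realType) (m n : nat) :=
  Uniform_isComplete.Build 'M[R]_(m, n) (@cauchy_cvg _).

Section FixedPoint.
Context {R : realType}.

Lemma coord_le_norm (n : nat) (u : 'rV[R]_n) (j : 'I_n) : `|u 0 j| <= `|u|.
Proof.
by rewrite [leRHS]/Num.norm/= mx_normrE; apply/bigmax_geP; right; exists (0, j).
Qed.

Lemma norm_le_enorm (n : nat) (u : 'rV[R]_n) : `|u| <= enorm u.
Proof.
rewrite [leLHS]/Num.norm/= mx_normrE; apply/bigmax_leP; split => [|[i j] _].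
  exact: enorm_ge0.
by rewrite ord1 coord_le_enorm.
Qed.

Lemma enorm_le_norm (n : nat) (u : 'rV[R]_n) : enorm u <= n%:R * `|u|.
Proof.
apply: le_trans (enorm_le_sum u) _.
rewrite mulr_natl -[X in _ *+ X](card_ord n) -sumr_const.
by apply: ler_sum => j _; exact: coord_le_norm.
Qed.

(* Some iterate of h contracts the sup norm, for which the library's fixed point
   theorem is stated; h permutes the fixed points of its iterate. *)
Lemma contraction_has_fixpoint (n : nat) (h : 'rV[R]_n -> 'rV[R]_n) (q : R) :
  0 <= q -> q < 1 ->
  (forall u v, enorm (h u - h v) <= q * enorm (u - v)) -> exists p, h p = p.
Proof.
move=> q0 q1 hq.
have hiter k u v : enorm (iter k h u - iter k h v) <= q ^+ k * enorm (u - v).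
  elim: k => [|k ih] /=; first by rewrite mul1r.
  by rewrite exprS -mulrA; apply: le_trans (hq _ _) _; rewrite ler_wpM2l.
(* Returning from the Euclidean norm to the sup norm costs a factor [n], which q^m has to beat. The
   proof compares with [n%:R + 1], which is positive even for n = 0. *)
have [m mq] : exists m, q ^+ m * n%:R < 1.
  have n1 : 0 < n%:R + 1 :> R by rewrite ltr_wpDl.
  have /cvgrPdist_lt /(_ ((n%:R + 1)^-1)) : (q ^+ k @[k --> \oo] --> (0:R)).
    by apply: cvg_expr; rewrite ger0_norm.
  rewrite invr_gt0 => /(_ n1)[m _ /(_ m (leqnn m))] /=.
  rewrite sub0r normrN ger0_norm ?exprn_ge0// => qm; exists m.
  apply: (@le_lt_trans _ _ (q ^+ m * (n%:R + 1))).
    by rewrite ler_wpM2l ?exprn_ge0// lerDl.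
  by rewrite -ltr_pdivlMr// div1r.
have qm0 : 0 <= q ^+ m * n%:R by rewrite mulr_ge0 ?exprn_ge0.
have ctr : is_contraction (totalfun_ setT (iter m h)).
  exists (NngNum qm0); split => //= -[u v] _ /=.
  apply: le_trans (norm_le_enorm _) _.
  apply: le_trans (hiter _ _ _) _.
  by rewrite -mulrA ler_wpM2l ?exprn_ge0// enorm_le_norm.
have [] := banach_fixed_point ctr; [exact: closedT|by exists 0|move=> p _ fp].
exists p; apply: (contraction_fixpoint_unique ctr) => //.
by change (h p = iter m h (h p)); rewrite -iterSr iterS; congr h; exact: fp.
Qed.

End FixedPoint.

(** * Descent inequality for a function with Lipschitz gradient *)

Section Descent.
Context {R : realType} {n : nat}.
Variables (J : 'rV[R]_n -> R) (K : R).
Hypothesis J_diff : forall y, differentiable J y.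

(** [grad] is built from partial derivatives; linearity of the differential, applied to the
    expansion of [v] in the standard basis, links the two. *)
Lemma diff_grad (y v : 'rV[R]_n) : 'd J y v = dotv (grad J y) v.
Proof.
have /= := linear_sum ('d J y) (index_enum 'I_n) xpredT
  (fun j => v 0 j *: (delta_mx 0 j : 'rV[R]_n)).
rewrite -row_sum_delta => ->; apply: eq_bigr => j _.
by rewrite linearZ /= mxE mulrC deriveE.
Qed.

Lemma is_derive_line (y v : 'rV[R]_n) (t : R) :
  is_derive t 1 (fun s => J (y + s *: v)) (dotv (grad J (y + t *: v)) v).
Proof.
have line_diff : is_diff t (fun s : R => y + s *: v) (fun s : R => s *: v).
  apply: (is_diff_eq (is_diffD (is_diff_cst y t) (is_diff_scalel t v))).
  by apply/funext => s; rewrite fctE add0r.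
have ld : differentiable (fun s : R => y + s *: v) t by case: line_diff.
have Jl : differentiable (J \o (fun s : R => y + s *: v)) t.
  by apply: differentiable_comp; [exact: ld|exact: J_diff].
apply: DeriveDef; first exact/derivable1_diffP.
rewrite deriveE// diff_comp//.
by rewrite /= diff_val scale1r diff_grad.
Qed.

Hypothesis grad_lipschitz :
  forall y1 y2, enorm (grad J y1 - grad J y2) <= K * enorm (y1 - y2).
Hypothesis K0 : 0 <= K.

(** The mean value theorem on [0, 1] expresses the increment through the gradient at one point of
    the segment, and the Lipschitz bound moves that gradient back to [y]. Using a single point
    instead of an integral gives the constant K rather than K / 2. *)
Lemma descent (y v : 'rV[R]_n) :
  J (y + v) <= J y + dotv (grad J y) v + K * enorm v ^+ 2.
Proof.
have [|c c01] := @MVT R (fun s => J (y + s *: v)) _ 0 1 ltr01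
  (fun t _ => is_derive_line y v t).
  apply: continuous_subspaceT => t.
  by apply/differentiable_continuous/derivable1_diffP; case: (is_derive_line y v t).
rewrite scale0r addr0 scale1r subr0 mulr1 => /eqP; rewrite subr_eq => /eqP ->.
rewrite [leLHS]addrC -[leRHS]addrA lerD2l -[grad J (y + c *: v)](subrK (grad J y)).
rewrite dotvDl [leLHS]addrC lerD2l.
apply: le_trans (cauchy_schwarz _ _) _; rewrite expr2 mulrA ler_wpM2r ?enorm_ge0//.
apply: le_trans (grad_lipschitz _ _) _; rewrite ler_wpM2l//.
rewrite addrC addKr enormZ; move: c01; rewrite in_itv/= => /andP[c0 c1].
by rewrite gtr0_norm// ler_piMl ?enorm_ge0// ltW.
Qed.

End Descent.

(** * Constants of the potential argument *)

Section Constants.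
Context {R : realType}.
Variables mu L : R.

(** Lipschitz constant of x^*; the next one is that of grad J, which is - G(x^*(y), y). *)
Definition fixpt_lip : R := L / (1 - mu).
Definition grad_lip : R := L * (fixpt_lip + 1).

(* Chosen so that the decrease [lyap_weight * (1 - mu) = L ^+ 2] of the squared
   tracking error absorbs its contribution to the descent of J. *)
Definition lyap_weight : R := L ^+ 2 / (1 - mu).

(** Twice the total coefficient of a b |G + M'|^2, which collects the second-order term of J and the
    drift of x^* weighted by [lyap_weight]. *)
Definition increment_weight : R :=
  2 * grad_lip + 4 * lyap_weight * fixpt_lip ^+ 2 / (1 - mu).

End Constants.

(** * Deterministic one-step inequalities *)

Section TwoTimescale.
Context {R : realType} {d1 d2 : nat}.
Variables (f : 'rV[R]_d1 -> 'rV[R]_d2 -> 'rV[R]_d1).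
Variables (g : 'rV[R]_d1 -> 'rV[R]_d2 -> 'rV[R]_d2).
Variables (J : 'rV[R]_d2 -> R) (mu L : R).
Hypotheses (mu_ge0 : 0 <= mu) (mu_lt1 : mu < 1) (L_gt0 : 0 < L).
Hypothesis f_contraction : forall (x1 x2 : 'rV[R]_d1) (y : 'rV[R]_d2),
  enorm (f x1 y - f x2 y) <= mu * enorm (x1 - x2).
Hypothesis f_lipschitz : forall (x : 'rV[R]_d1) (y1 y2 : 'rV[R]_d2),
  enorm (f x y1 - f x y2) <= L * enorm (y1 - y2).

Local Notation c := (1 - mu).
Local Notation L0 := (fixpt_lip mu L).
Local Notation LJ := (grad_lip mu L).
Local Notation kap := (lyap_weight mu L).
Local Notation Q := (increment_weight mu L).

Let c_gt0 : 0 < c. Proof. by rewrite subr_gt0. Qed.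
Let c_le1 : c <= 1. Proof. by rewrite lerBlDr lerDl. Qed.
Let L0_gt0 : 0 < L0. Proof. exact: divr_gt0. Qed.

Lemma fixptE (y : 'rV[R]_d2) : f (fixpt f y) y = fixpt f y.
Proof.
have [p fp] := contraction_has_fixpoint mu_ge0 mu_lt1
  (fun x1 x2 => f_contraction x1 x2 y).
by apply: (@getPex _ [set x | f x y = x]); exists p.
Qed.

(** Passing through [f (fixpt f y2) y1] bounds the distance by mu times itself plus L |y1 - y2|. *)
Lemma fixpt_lipschitz (y1 y2 : 'rV[R]_d2) :
  enorm (fixpt f y1 - fixpt f y2) <= L0 * enorm (y1 - y2).
Proof.
rewrite /fixpt_lip mulrAC ler_pdivlMr// mulrBr mulr1 lerBlDr.
rewrite -{1}(fixptE y1) -{1}(fixptE y2) [leRHS]addrC.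
apply: le_trans (enormB_trans (f (fixpt f y2) y1) _ _) _.
by rewrite lerD// mulrC f_contraction.
Qed.

Hypothesis g_gradient : forall y : 'rV[R]_d2, g (fixpt f y) y - y = - grad J y.
Hypothesis G_lipschitz : forall (x1 x2 : 'rV[R]_d1) (y1 y2 : 'rV[R]_d2),
  enorm ((g x1 y1 - y1) - (g x2 y2 - y2))
    <= L * (enorm (x1 - x2) + enorm (y1 - y2)).

Let LJ_gt0 : 0 < LJ. Proof. by rewrite mulr_gt0// addr_gt0. Qed.

Lemma grad_lipschitz (y1 y2 : 'rV[R]_d2) :
  enorm (grad J y1 - grad J y2) <= LJ * enorm (y1 - y2).
Proof.
rewrite -enormN opprB addrC -g_gradient -[grad J y2]opprK -g_gradient.
apply: le_trans (G_lipschitz _ _ _ _) _.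
by rewrite /grad_lip -mulrA ler_pM2l// mulrDl mul1r lerD2r fixpt_lipschitz.
Qed.

Hypothesis J_diff : forall y, differentiable J y.

Let kap_gt0 : 0 < kap. Proof. by apply: divr_gt0 => //; exact: exprn_gt0. Qed.
Let Q_gt0 : 0 < Q.
Proof.
apply: addr_gt0; first exact: mulr_gt0.
by apply: divr_gt0 => //; apply: mulr_gt0; [exact: mulr_gt0|exact: exprn_gt0].
Qed.

(** The noiseless fast update measured from the old fixed point x^*(y), hence the conditional mean
    of x_{k+1} - x^*(y_k). *)
Definition tracking_mean (a : R) (x : 'rV[R]_d1) (y : 'rV[R]_d2) : 'rV[R]_d1 :=
  x - fixpt f y + a *: (f x y - x).

(** The fixed point equation makes this vector (1 - a) z + a (f(x, y) - f(x^*(y), y)), a convex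
    combination whose second term contracts by mu. *)
Lemma enorm_tracking_mean a x y : 0 <= a <= 1 ->
  enorm (tracking_mean a x y) <= (1 - c * a) * enorm (x - fixpt f y).
Proof.
move=> /andP[a0 a1]; set z := x - fixpt f y.
have -> : tracking_mean a x y = (1 - a) *: z + a *: (f x y - f (fixpt f y) y).
  by rewrite fixptE; apply/rowP => j; rewrite !mxE; ring.
apply: le_trans (enormD _ _) _; rewrite !enormZ !ger0_norm ?subr_ge0//.
have -> : 1 - c * a = (1 - a) + a * mu by ring.
by rewrite [leRHS]mulrDl lerD2l -mulrA ler_wpM2l.
Qed.

(** The direction G(x, y) differs from - grad J(y) by at most L |z|. Splitting the cross product
    |grad J| L |z| evenly leaves half of the decrease b |grad J|^2. *)
Lemma J_step (x : 'rV[R]_d1) (y m : 'rV[R]_d2) (b : R) : 0 <= b ->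
  J (y + b *: (g x y - y + m)) <= J y - b / 2 * enorm (grad J y) ^+ 2
    + b / 2 * L ^+ 2 * enorm (x - fixpt f y) ^+ 2 + b * dotv (grad J y) m
    + LJ * b ^+ 2 * enorm (g x y - y + m) ^+ 2.
Proof.
move=> b0; set h := g x y - y; set D := grad J y; set z := x - fixpt f y.
apply: le_trans (descent J_diff grad_lipschitz (ltW LJ_gt0) _ _) _.
rewrite enormZ ger0_norm// exprMn mulrA lerD2r dotvZr dotvDr -/D.
have hD : enorm (h + D) <= L * enorm z.
  rewrite -[D]opprK -g_gradient; apply: le_trans (G_lipschitz _ _ _ _) _.
  by rewrite subrr enorm0 addr0.
have Dh : dotv D h <= - (enorm D ^+ 2) / 2 + (L * enorm z) ^+ 2 / 2.
  have -> : dotv D h = dotv D (h + D) - enorm D ^+ 2.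
    by rewrite dotvDr enorm_sqr addrK.
  have : dotv D (h + D) <= enorm D * (L * enorm z).
    by apply: le_trans (cauchy_schwarz _ _) _; rewrite ler_wpM2l ?enorm_ge0.
  have := sqr_ge0 (enorm D - L * enorm z).
  rewrite sqrrB; lra.
have := ler_wpM2l b0 Dh; rewrite exprMn; lra.
Qed.

Lemma enorm_increment (x : 'rV[R]_d1) (y m : 'rV[R]_d2) :
  enorm (g x y - y + m) ^+ 2 <= 4 * enorm (grad J y) ^+ 2
    + 4 * (L ^+ 2 * enorm (x - fixpt f y) ^+ 2) + 2 * enorm m ^+ 2.
Proof.
set h := g x y - y; set D := grad J y; set z := x - fixpt f y.
have hD : enorm (h + D) <= L * enorm z.
  rewrite -[D]opprK -g_gradient; apply: le_trans (G_lipschitz _ _ _ _) _.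
  by rewrite subrr enorm0 addr0.
have := enorm_sqrD_le h m (@ltr01 R).
have : enorm h ^+ 2 <= 2 * enorm (h + D) ^+ 2 + 2 * enorm D ^+ 2.
  have := enorm_sqrD_le (h + D) (- D) (@ltr01 R); rewrite addrK enormN invr1; lra.
have : enorm (h + D) ^+ 2 <= L ^+ 2 * enorm z ^+ 2.
  by rewrite -exprMn ler_pXn2r ?nnegrE ?mulr_ge0 ?enorm_ge0// ltW.
rewrite invr1; lra.
Qed.

(** Young's inequality with t = c a separates the contracted error from the drift of x^*. Since (1 +
    c a) (1 - c a)^2 <= 1 - c a, one of the two factors 1 - c a survives and yields the decrease b c
    |z|^2. *)
Lemma tracking_step (x m : 'rV[R]_d1) (y v : 'rV[R]_d2) (a b : R) :
  0 < a <= 1 -> 0 < b -> b ^+ 2 <= a ^+ 3 ->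
  b / a * enorm (x + a *: (f x y - x + m) - fixpt f (y + b *: v)) ^+ 2
    <= (b / a - b * c) * enorm (x - fixpt f y) ^+ 2
     + 2 * b * (1 + c * a) * dotv (tracking_mean a x y) m
     + 2 * b * a * enorm m ^+ 2 + 2 * L0 ^+ 2 / c * (a * b) * enorm v ^+ 2.
Proof.
move=> /andP[a0 a1] b0 ba; set A := tracking_mean a x y; set z := x - fixpt f y.
have ca0 : 0 < c * a by exact: mulr_gt0.
have ca1 : c * a <= 1 by apply: mulr_ile1 => //; exact: ltW.
have -> : x + a *: (f x y - x + m) - fixpt f (y + b *: v) =
    (A + a *: m) + (fixpt f y - fixpt f (y + b *: v)).
  rewrite /A /tracking_mean scalerDr; apply/rowP => j; rewrite !mxE; ring.
apply: (@le_trans _ _ (b / a * ((1 + c * a) * (enorm A ^+ 2 +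
    2 * a * dotv A m + a ^+ 2 * enorm m ^+ 2)
    + (1 + (c * a)^-1) * (L0 ^+ 2 * (b ^+ 2 * enorm v ^+ 2))))).
  rewrite ler_pM2l ?divr_gt0//; apply: le_trans (enorm_sqrD_le _ _ ca0) _.
  apply: lerD.
    by rewrite enorm_sqrD dotvZr enormZ gtr0_norm// exprMn mulrA.
  have ica0 : 0 <= 1 + (c * a)^-1 by rewrite addr_ge0// invr_ge0 ltW.
  rewrite ler_wpM2l// -!exprMn.
  have bv0 : 0 <= L0 * (b * enorm v).
    by apply: mulr_ge0; [exact: ltW|apply: mulr_ge0; [exact: ltW|exact: enorm_ge0]].
  rewrite ler_pXn2r ?nnegrE ?enorm_ge0//.
  apply: le_trans (fixpt_lipschitz _ _) _.
  by rewrite opprD addrA subrr sub0r enormN enormZ gtr0_norm// mulrA.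
have hA : (1 + c * a) * enorm A ^+ 2 <= (1 - c * a) * enorm z ^+ 2.
  have A2 : enorm A ^+ 2 <= (1 - c * a) ^+ 2 * enorm z ^+ 2.
    rewrite -exprMn ler_pXn2r ?nnegrE ?mulr_ge0 ?enorm_ge0 ?subr_ge0//.
    by rewrite enorm_tracking_mean// a1 ltW.
  apply: (@le_trans _ _ ((1 + c * a) * ((1 - c * a) ^+ 2 * enorm z ^+ 2))).
    by rewrite ler_pM2l// addr_gt0.
  rewrite mulrA ler_wpM2r ?sqr_ge0// expr2 mulrA ler_piMl ?subr_ge0//.
  have := sqr_ge0 (c * a); rewrite expr2; lra.
have hm : (1 + c * a) * enorm m ^+ 2 <= 2 * enorm m ^+ 2.
  by rewrite ler_wpM2r ?sqr_ge0//; lra.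
(* Here b^2 <= a^3 enters: it cancels the factor 1 / (c a) from Young's inequality and the weight b
   / a, so that the drift is of order a b. *)
have hv : b / a * ((1 + (c * a)^-1) * b ^+ 2) <= 2 / c * (a * b).
  apply: (@le_trans _ _ (b / a * ((2 * (c * a)^-1) * a ^+ 3))).
    have ica1 : 1 <= (c * a)^-1 by rewrite invf_ge1.
    rewrite ler_pM2l ?divr_gt0//; apply: ler_pM; rewrite ?sqr_ge0//; lra.
  rewrite le_eqVlt; apply/orP; left; apply/eqP; field.
  by rewrite !gt_eqF.
have h1 := ler_wpM2l (ltW (divr_gt0 b0 a0)) hA.
have h2 := ler_wpM2l (ltW (mulr_gt0 a0 b0)) hm.
have h3 := ler_wpM2r (mulr_ge0 (sqr_ge0 L0) (sqr_ge0 (enorm v))) hv.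
have ab : b / a * a = b by rewrite divfK// gt_eqF.
have -> : b / a * ((1 + c * a) *
      (enorm A ^+ 2 + 2 * a * dotv A m + a ^+ 2 * enorm m ^+ 2)
    + (1 + (c * a)^-1) * (L0 ^+ 2 * (b ^+ 2 * enorm v ^+ 2))) =
   b / a * ((1 + c * a) * enorm A ^+ 2) + 2 * b * (1 + c * a) * dotv A m
   + a * b * ((1 + c * a) * enorm m ^+ 2)
   + b / a * ((1 + (c * a)^-1) * b ^+ 2) * (L0 ^+ 2 * enorm v ^+ 2).
  by field; rewrite !gt_eqF.
have -> : (b / a - b * c) * enorm z ^+ 2 = b / a * ((1 - c * a) * enorm z ^+ 2).
  by rewrite -[in b * c]ab; ring.
have -> : 2 * L0 ^+ 2 / c * (a * b) * enorm v ^+ 2 =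
  2 / c * (a * b) * (L0 ^+ 2 * enorm v ^+ 2) by ring.
lra.
Qed.

Lemma lyapunov_step (x m : 'rV[R]_d1) (y m' : 'rV[R]_d2) (a b : R) :
  0 < a <= 1 -> 0 < b -> b ^+ 2 <= a ^+ 3 -> a * (8 * Q) <= 1 ->
  J (y + b *: (g x y - y + m')) + kap * (b / a) *
      enorm (x + a *: (f x y - x + m) -
             fixpt f (y + b *: (g x y - y + m'))) ^+ 2
  <= J y + kap * (b / a) * enorm (x - fixpt f y) ^+ 2
     - b / 4 * enorm (grad J y) ^+ 2 + b * dotv (grad J y) m'
     + 2 * kap * b * (1 + c * a) * dotv (tracking_mean a x y) m
     + (Q + 2 * kap) * (b * a) * (enorm m ^+ 2 + enorm m' ^+ 2).
Proof.
move=> a01 b0 ba aQ; have /andP[a0 a1] := a01.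
(* From b^2 <= a^3 <= a^2; it turns the b^2 of the descent step into a b. *)
have b_le_a : b <= a.
  rewrite -(ler_pXn2r (ltn0Sn 1)) ?nnegrE ?(ltW a0) ?(ltW b0)// (le_trans ba)// exprS.
  by rewrite ler_piMl ?sqr_ge0.
have h1 := J_step x y m' (ltW b0).
have h2 := ler_wpM2l (ltW kap_gt0)
  (tracking_step x m y (g x y - y + m') a01 b0 ba).
have h3 := enorm_increment x y m'.
move: h1 h2 h3; set D2 := enorm (grad J y) ^+ 2.
set Z2 := enorm (x - fixpt f y) ^+ 2; set S := enorm (g x y - y + m') ^+ 2.
set W := enorm (x + _ - _) ^+ 2; set N := enorm m ^+ 2.
set N' := enorm m' ^+ 2; set P := dotv (grad J y) m'.
set P' := dotv (tracking_mean a x y) m => h1 h2 h3.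
have [S0 N0 N0'] : [/\ 0 <= S, 0 <= N & 0 <= N'] by split; exact: sqr_ge0.
have [D0 Z0] : 0 <= D2 /\ 0 <= Z2 by split; exact: sqr_ge0.
have ab0 : 0 < a * b by exact: mulr_gt0.
have h4 : LJ * b ^+ 2 * S <= LJ * (a * b) * S.
  by rewrite ler_wpM2r// ler_pM2l// expr2 ler_pM2r.
(* The smallness of [a] spends b / 4 of the available b / 2 on |grad J|^2. The same amount of L^2
   |z|^2 joins the b / 2 from [J_step]; their sum stays below b L^2 |z|^2, the tracking decrease. *)
have h5 : Q / 2 * (a * b) * S
    <= b / 4 * D2 + b / 4 * (L ^+ 2 * Z2) + Q * (a * b) * N'.
  apply: (@le_trans _ _ (Q / 2 * (a * b) * (4 * D2 + 4 * (L ^+ 2 * Z2) + 2 * N'))).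
    by rewrite ler_pM2l// mulr_gt0// divr_gt0.
  have E0 : 0 <= b * (D2 + L ^+ 2 * Z2).
    by rewrite pmulr_rge0// addr_ge0// mulr_ge0// sqr_ge0.
  have := ler_wpM2r E0 aQ; lra.
have kc : kap * c = L ^+ 2 by rewrite /lyap_weight divfK// gt_eqF.
have Qe : LJ + kap * (2 * L0 ^+ 2 / c) = Q / 2.
  by rewrite /increment_weight; field; rewrite gt_eqF.
have h6 : LJ * (a * b) * S + kap * (2 * L0 ^+ 2 / c * (a * b) * S)
    = Q / 2 * (a * b) * S.
  by rewrite -Qe; ring.
have h7 : kap * ((b / a - b * c) * Z2) = kap * (b / a) * Z2 - b * (L ^+ 2 * Z2).
  by rewrite -kc; ring.
have h8 : 0 <= Q * (a * b) * N by rewrite mulr_ge0// ltW// mulr_gt0.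
have h9 : 0 <= kap * (a * b) * N' by rewrite mulr_ge0// ltW// mulr_gt0.
have h10 : 0 <= b * (L ^+ 2 * Z2).
  by rewrite pmulr_rge0// mulr_ge0// sqr_ge0.
lra.
Qed.

End TwoTimescale.

(** * Measurability of continuous functions of random vectors *)

Section VectorMeasurability.
Context {R : realType}.

(* The event [c < phi X] is the union of the events that X lies in a cube with
   rational centre and radius 1/(k+1) on which c < phi. *)
Lemma measurable_continuous_rV d (T : measurableType d) (n : nat)
    (phi : 'rV[R]_n -> R) (X : T -> 'rV[R]_n) :
  continuous phi -> (forall j, measurable_fun setT (fun w => X w 0 j)) ->
  measurable_fun setT (fun w => phi (X w)).
Proof.
move=> cphi mX _; apply: (measurability _ (RGenOInfty.measurableE R)) => //.
move=> /= _ [_ [a ->] <-]; rewrite preimage_itvoy setTI.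
pose cube (q : 'rV[rat]_n) (k : nat) (v : 'rV[R]_n) :=
  forall j, `|v 0 j - ratr (q 0 j)| < k.+1%:R^-1.
rewrite [X in measurable X](_ : _ = \bigcup_(p : 'rV[rat]_n * nat)
  [set w | (forall v, cube p.1 p.2 v -> a < phi v) /\ cube p.1 p.2 (X w)]).
  apply: countable_bigcupT_measurable => [|[q k] /=]; first exact: countableP.
  have [h|h] := pselect (forall v, cube q k v -> a < phi v); last first.
    rewrite [X in measurable X](_ : _ = set0)//.
    by apply/seteqP; split => // w [].
  rewrite [X in measurable X](_ : _ = \big[setI/setT]_(j < n)
    [set w | `|X w 0 j - ratr (q 0 j)| < k.+1%:R^-1]).
    apply: bigsetI_measurable => j _.
    have mf : measurable_fun setT (fun w => `|X w 0 j - ratr (q 0 j)|).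
      apply: measurableT_comp; first exact: normr_measurable.
      by apply: measurable_funB => //; exact: measurable_cst.
    have := mf measurableT _ (measurable_itv `]-oo, k.+1%:R^-1[).
    by rewrite preimage_itvNyo setTI.
  apply/seteqP; split => w.
    move=> [_ cw]; apply: (big_ind (fun A : set T => A w)) => //= j _; exact: cw.
  by move=> hw; split => // j; move: hw; rewrite (bigD1 j)//= => -[].
apply/seteqP; split => [w /= aw|w [[q k] _ [/= h /h]]//].
have : \forall v \near X w, a < phi v.
  exact: (cvgr_gt (phi (X w)) (cphi (X w))).
move=> /nbhs_ballP[e /= e0 he].
(* Two points of a cube of radius 1/(k+1) differ by less than 2/(k+1) in each coordinate, hence the
   choice 1/(k+1) < e / 2. *)
have [k _ /(_ k (leqnn k)) /= ke] := 
  near_infty_natSinv_lt (PosNum (divr_gt0 e0 (ltr0Sn R 1))).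
have hq j : exists q : rat, `|X w 0 j - ratr q| < k.+1%:R^-1.
  have : X w 0 j - k.+1%:R^-1 < X w 0 j + k.+1%:R^-1.
    have : 0 < k.+1%:R^-1 :> R by rewrite invr_gt0.
    by move: (k.+1%:R^-1) (X w 0 j) => r t; lra.
  move=> /rat_in_itvoo[q]; rewrite in_itv/= => /andP[q1 q2]; exists q.
  move: (k.+1%:R^-1) q1 q2 => r q1 q2.
  by rewrite ltr_norml; apply/andP; split; lra.
have [q hq'] := choice hq.
exists (\row_j q j, k) => //=; split => [v cv|j]; last by rewrite mxE.
apply: he; split => // i j; rewrite ord1 /ball/= /ball_/=.
have := cv j; have := hq' j; rewrite mxE => h1 h2.
have -> : X w 0 j - v 0 j = (X w 0 j - ratr (q j)) - (v 0 j - ratr (q j)) by ring.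
apply: le_lt_trans (ler_normB _ _) _.
by move: (k.+1%:R^-1) ke h1 h2 => r; lra.
Qed.

Lemma lipschitz_continuous_rV (n : nat) (phi : 'rV[R]_n -> R) (K : R) :
  (forall u v, `|phi u - phi v| <= K * enorm (u - v)) -> continuous phi.
Proof.
move=> phiK v; apply/(@cvgrPdist_lt _ R _ (nbhs v) (nbhs_filter v)) => e e0.
(* The summand 1 keeps the divisor positive when [K] or [n] is zero. *)
have K0 : 0 < `|K| * n%:R + 1 by rewrite ltr_wpDl// mulr_ge0.
apply/nbhs_ballP; exists (e / (`|K| * n%:R + 1)); first exact: divr_gt0.
move=> u; rewrite -ball_normE/= ltr_pdivlMr// mulrC => ue.
apply: le_lt_trans ue; apply: le_trans (phiK _ _) _.
apply: (@le_trans _ _ (`|K| * (n%:R * `|v - u|))).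
  apply: le_trans (ler_norm _) _; rewrite normrM ler_wpM2l//.
  by rewrite ger0_norm ?enorm_ge0// enorm_le_norm.
by rewrite mulrA ler_wpM2r// lerDl.
Qed.

(** Concatenating the two vectors into one row reduces the claim to a continuous function of a
    single random vector. *)
Lemma measurable_lipschitz2 d (T : measurableType d) (d1 d2 : nat)
    (phi : 'rV[R]_d1 -> 'rV[R]_d2 -> R) (K : R)
    (X : T -> 'rV[R]_d1) (Y : T -> 'rV[R]_d2) :
  0 <= K ->
  (forall x1 x2 y1 y2,
     `|phi x1 y1 - phi x2 y2| <= K * (enorm (x1 - x2) + enorm (y1 - y2))) ->
  (forall j, measurable_fun setT (fun w => X w 0 j)) ->
  (forall j, measurable_fun setT (fun w => Y w 0 j)) ->
  measurable_fun setT (fun w => phi (X w) (Y w)).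
Proof.
move=> K0 phiK mX mY.
have sub_enorm m (u : 'rV[R]_m) (r : R) :
    (forall j, `|u 0 j| <= r) -> enorm u <= m%:R * r.
  move=> ur; apply: le_trans (enorm_le_sum u) _.
  rewrite mulr_natl -[X in _ *+ X](card_ord m) -sumr_const.
  by apply: ler_sum => j _; exact: ur.
pose psi (v : 'rV[R]_(d1 + d2)) := phi (lsubmx v) (rsubmx v).
rewrite (_ : (fun w => _) = (fun w => psi (row_mx (X w) (Y w)))); last first.
  by apply/funext => w; rewrite /psi row_mxKl row_mxKr.
apply: measurable_continuous_rV => [|j].
  apply: (@lipschitz_continuous_rV _ _ (K * (d1%:R + d2%:R))) => u v.
  apply: le_trans (phiK _ _ _ _) _; rewrite -mulrA ler_wpM2l// mulrDl.
  by rewrite -!raddfB lerD// sub_enorm// => j; rewrite mxE coord_le_enorm.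
rewrite (_ : (fun w => _) = (fun w => match fintype.split j with
  inl i => X w 0 i | inr i => Y w 0 i end)); last first.
  by apply/funext => w; rewrite mxE.
by case: (fintype.split j).
Qed.

End VectorMeasurability.

(** * Products of adapted and conditionally centered variables *)

Import HBNNSimple.

Section CenteredProduct.
Context {R : realType} d (T : measurableType d) (P : probability T R).
Variable G : set (set T).
Hypothesis sub_measurable : <<s G >> `<=` measurable.

Local Notation TG := (g_sigma_algebraType G).

Lemma sub_measurable_fun (X : T -> R) :
  measurable_fun setT (X : TG -> R) -> measurable_fun setT X.
Proof. by move=> mX _ B mB; apply: sub_measurable; exact: mX. Qed.

Variable m : T -> R.
Hypothesis m_centered : is_cond_exp P <<s G >> m (fun=> 0).

Let im : P.-integrable setT (EFin \o m). Proof. by case: m_centered. Qed.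
Let mm : measurable_fun setT m.
Proof. by apply/measurable_EFinP; exact: (measurable_int _ im). Qed.

Let indic_centered (A : set T) : <<s G >> A ->
  P.-integrable setT (fun w => (\1_A w * m w)%:E) /\
  (\int[P]_w (\1_A w * m w)%:E = 0)%E.
Proof.
move=> GA; have mA : measurable A by exact: sub_measurable.
have e : (fun w => (\1_A w * m w)%:E) = (EFin \o m) \_ A.
  apply/funext => w; rewrite /patch/= indicE.
  by case: (w \in A); rewrite ?mul1r ?mul0r.
split.
  apply: (le_integrable measurableT _ _ im).
    by apply/measurable_EFinP; apply: measurable_funM => //; exact: measurable_indic.
  move=> w _; rewrite /= lee_fin normrM indicE.
  by rewrite ler_piMl//; case: (w \in A); rewrite ?normr1 ?normr0.
rewrite e -integral_mkcond; case: m_centered => _ _ _ /(_ _ GA) <-.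
by rewrite integral0.
Qed.

Let nnsfun_centered (h : {nnsfun TG >-> R}) :
  (\int[P]_w (h w * m w)%:E = 0)%E.
Proof.
pose s : seq R := finmap.enum_fset (fset_set (range h)).
have GA y : <<s G >> (h @^-1` [set y]).
  by have := measurable_funPTI h (measurable_set1 y).
transitivity (\int[P]_w \sum_(y <- s)
    (y%:E * (\1_(h @^-1` [set y]) w * m w)%:E))%E.
  apply: eq_integral => w _; rewrite (fimfunE h w) fsbig_finite//= mulr_suml -sumEFin.
  by apply: eq_bigr => y _; rewrite -mulrA.
rewrite integral_sum//; last first.
  by move=> y; apply: integrableZl => //; case: (indic_centered (GA y)).
rewrite big1// => y _; rewrite integralZl//; last by case: (indic_centered (GA y)).
by case: (indic_centered (GA y)) => _ ->; rewrite mule0.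
Qed.

Let ge0_centered (X : T -> R) : (forall w, 0 <= X w) ->
  measurable_fun setT (X : TG -> R) ->
  P.-integrable setT (fun w => (X w * m w)%:E) ->
  (\int[P]_w (X w * m w)%:E = 0)%E.
Proof.
move=> X0 mX iX.
have mEX : measurable_fun setT (EFin \o X : TG -> \bar R).
  exact/measurable_EFinP.
(* The approximants are simple functions over [TG], so their level sets are events of [<<s G >>].
   They lie between 0 and X, and |X m| dominates the products. *)
pose h := nnsfun_approx measurableT mEX.
have hX w : h n w @[n --> \oo] --> X w.
  by have /fine_cvgP[] :=
    cvg_nnsfun_approx measurableT mEX (fun w _ => X0 w) (x := w) Logic.I.
have hle n w : h n w <= X w.
  rewrite -(cvg_lim (@Rhausdorff R) (hX w)).
  apply: (nondecreasing_cvgn_le (u_ := fun n => h n w)); last exact: cvgP (hX w).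
  by move=> i j ij; exact/lefP/nd_nnsfun_approx.
have [] := @dominated_convergence _ _ _ P setT measurableT
  (fun n w => (h n w * m w)%:E) (fun w => (X w * m w)%:E)
  (fun w => `|(X w * m w)%:E|)%E.
- move=> n; apply/measurable_EFinP; apply: measurable_funM => //.
  by apply: sub_measurable_fun; exact: measurable_funPT.
- exact: (measurable_int _ iX).
- apply: aeW => w _; apply: cvg_EFin; first exact: nearW.
  by apply: cvgMr_tmp; exact: hX.
- exact: integrable_abse.
- apply: aeW => w n _; rewrite !lee_fin !normrM ler_wpM2r//.
  by rewrite !ger0_norm ?hle.
move=> _ _; under eq_fun do rewrite nnsfun_centered.
by move=> /cvg_lim <- //; rewrite lim_cst.
Qed.

(** Defining property on indicators, linearity for simple functions, dominated convergence for
    nonnegative ones, then positive and negative parts. Both parts are bounded by |X|, so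
    integrability of X m alone suffices throughout. *)
Lemma integral_mul_centered (X : T -> R) :
  measurable_fun setT (X : TG -> R) ->
  P.-integrable setT (fun w => (X w * m w)%:E) ->
  (\int[P]_w (X w * m w)%:E = 0)%E.
Proof.
move=> mX iX.
have mabs : measurable_fun setT ((fun w => `|X w|) : TG -> R).
  exact: measurableT_comp.
have mle (Y : T -> R) : measurable_fun setT (Y : TG -> R) ->
    (forall w, `|Y w| <= `|X w|) ->
    P.-integrable setT (fun w => (Y w * m w)%:E).
  move=> mY YX; apply: (le_integrable measurableT _ _ iX).
    by apply/measurable_EFinP; apply: measurable_funM => //; exact: sub_measurable_fun.
  by move=> w _; rewrite lee_fin !normrM ler_wpM2r.
pose Xp w := (`|X w| + X w) / 2; pose Xn w := (`|X w| - X w) / 2.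
have mXp : measurable_fun setT (Xp : TG -> R).
  by apply: measurable_funM => //; exact: measurable_funD.
have mXn : measurable_fun setT (Xn : TG -> R).
  by apply: measurable_funM => //; exact: measurable_funB.
have Xp0 w : 0 <= Xp w.
  by rewrite divr_ge0//; have := ler_norm (- X w); rewrite normrN; lra.
have Xn0 w : 0 <= Xn w by rewrite divr_ge0// subr_ge0 ler_norm.
have iXp : P.-integrable setT (fun w => (Xp w * m w)%:E).
  apply: mle => // w; rewrite ger0_norm// ler_pdivrMr//.
  by have := ler_norm (X w); lra.
have iXn : P.-integrable setT (fun w => (Xn w * m w)%:E).
  apply: mle => // w; rewrite ger0_norm// ler_pdivrMr//.
  by have := ler_norm (- X w); rewrite normrN; lra.
transitivity (\int[P]_w ((Xp w * m w)%:E - (Xn w * m w)%:E))%E.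
  by apply: eq_integral => w _; rewrite -EFinB; congr EFin; rewrite /Xp /Xn; field.
by rewrite integralB// !ge0_centered// sube0.
Qed.

End CenteredProduct.

(** * Integrable variables and square-integrable random vectors *)

Section SquareIntegrable.
Context {R : realType} d (T : measurableType d) (P : probability T R).

(** The domain is a parameter so that the same predicate expresses adaptedness, over the type
    carrying a sub-sigma-algebra. *)
Definition measurable_rV d' (U : measurableType d') (n : nat)
    (X : U -> 'rV[R]_n) :=
  forall j, measurable_fun setT (fun w => X w 0 j).

Lemma measurable_dotv d' (U : measurableType d') (n : nat) (X Y : U -> 'rV[R]_n) :
  measurable_rV X -> measurable_rV Y ->
  measurable_fun setT (fun w => dotv (X w) (Y w)).
Proof. by move=> mX mY; apply: measurable_sum => j; exact: measurable_funM. Qed.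

Lemma measurable_enorm_sqr d' (U : measurableType d') (n : nat)
    (X : U -> 'rV[R]_n) :
  measurable_rV X -> measurable_fun setT (fun w => enorm (X w) ^+ 2).
Proof.
move=> mX; under eq_fun do rewrite enorm_sqr; exact: measurable_dotv.
Qed.

Lemma measurable_rVD d' (U : measurableType d') (n : nat) (X Y : U -> 'rV[R]_n) :
  measurable_rV X -> measurable_rV Y -> measurable_rV (fun w => X w + Y w).
Proof.
by move=> mX mY j; under eq_fun do rewrite mxE; exact: measurable_funD.
Qed.

Lemma measurable_rVZ d' (U : measurableType d') (n : nat) (a : R)
    (X : U -> 'rV[R]_n) :
  measurable_rV X -> measurable_rV (fun w => a *: X w).
Proof.
by move=> mX j; under eq_fun do rewrite mxE; exact: measurable_funM.
Qed.

Lemma measurable_rVB d' (U : measurableType d') (n : nat) (X Y : U -> 'rV[R]_n) :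
  measurable_rV X -> measurable_rV Y -> measurable_rV (fun w => X w - Y w).
Proof.
by move=> mX mY j; under eq_fun do rewrite !mxE; exact: measurable_funB.
Qed.

Lemma measurable_rV_lipschitz d' (U : measurableType d') (d1 d2 n : nat)
    (F : 'rV[R]_d1 -> 'rV[R]_d2 -> 'rV[R]_n) (K : R)
    (X : U -> 'rV[R]_d1) (Y : U -> 'rV[R]_d2) :
  0 <= K ->
  (forall x1 x2 y1 y2,
     enorm (F x1 y1 - F x2 y2) <= K * (enorm (x1 - x2) + enorm (y1 - y2))) ->
  measurable_rV X -> measurable_rV Y -> measurable_rV (fun w => F (X w) (Y w)).
Proof.
move=> K0 FK mX mY j.
apply: (@measurable_lipschitz2 _ _ _ _ _ (fun x y => F x y 0 j) K) => //.
move=> x1 x2 y1 y2; apply: le_trans (FK _ _ _ _).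
by have := coord_le_enorm (F x1 y1 - F x2 y2) j; rewrite !mxE.
Qed.

Definition L1 (X : T -> R) := P.-integrable setT (EFin \o X).

Lemma L1_dominated (X Y : T -> R) : measurable_fun setT X ->
  (forall w, `|X w| <= Y w) -> L1 Y -> L1 X.
Proof.
move=> mX XY; apply: le_integrable => //; first exact/measurable_EFinP.
by move=> w _; rewrite /= lee_fin (le_trans (XY w))// ler_norm.
Qed.

Lemma L1D (X Y : T -> R) : L1 X -> L1 Y -> L1 (fun w => X w + Y w).
Proof. by move=> iX iY; exact: (integrableD measurableT iX iY). Qed.

Lemma L1Z (a : R) (X : T -> R) : L1 X -> L1 (fun w => a * X w).
Proof. by move=> iX; exact: (integrableZl measurableT a iX). Qed.

Lemma L1B (X Y : T -> R) : L1 X -> L1 Y -> L1 (fun w => X w - Y w).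
Proof. by move=> iX iY; exact: (integrableB measurableT iX iY). Qed.

Lemma L1_cst (a : R) : L1 (fun=> a).
Proof. exact: finite_measure_integrable_cst. Qed.

Definition L2 (n : nat) (X : T -> 'rV[R]_n) :=
  measurable_rV X /\ L1 (fun w => enorm (X w) ^+ 2).

Lemma L2_dominated (n : nat) (X : T -> 'rV[R]_n) (Y : T -> R) :
  measurable_rV X -> (forall w, enorm (X w) ^+ 2 <= Y w) -> L1 Y -> L2 X.
Proof.
move=> mX XY iY; split => //; apply: L1_dominated iY => [|w].
  exact: measurable_enorm_sqr.
by rewrite ger0_norm ?sqr_ge0.
Qed.

Lemma L2_cst (n : nat) (v : 'rV[R]_n) : L2 (fun=> v).
Proof. by split => [j|]; [exact: measurable_cst|exact: L1_cst]. Qed.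

Lemma L2D (n : nat) (X Y : T -> 'rV[R]_n) :
  L2 X -> L2 Y -> L2 (fun w => X w + Y w).
Proof.
move=> [mX iX] [mY iY]; have iXY := L1D (L1Z 2 iX) (L1Z 2 iY).
apply: L2_dominated iXY => [|w]; first exact: measurable_rVD.
by have := enorm_sqrD_le (X w) (Y w) (@ltr01 R); rewrite invr1.
Qed.

Lemma L2Z (n : nat) (a : R) (X : T -> 'rV[R]_n) :
  L2 X -> L2 (fun w => a *: X w).
Proof.
move=> [mX iX]; apply: L2_dominated (L1Z (a ^+ 2) iX) => [|w].
  exact: measurable_rVZ.
by rewrite enormZ exprMn real_normK ?num_real.
Qed.

Lemma L2B (n : nat) (X Y : T -> 'rV[R]_n) :
  L2 X -> L2 Y -> L2 (fun w => X w - Y w).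
Proof.
move=> LX LY; have := L2D LX (L2Z (-1) LY).
by under eq_fun do rewrite scaleN1r.
Qed.

(** A Lipschitz map grows at most linearly: away from the constant [F 0 0], its square is at most 2
    K^2 (|X|^2 + |Y|^2). *)
Lemma L2_lipschitz (d1 d2 n : nat) (F : 'rV[R]_d1 -> 'rV[R]_d2 -> 'rV[R]_n)
    (K : R) (X : T -> 'rV[R]_d1) (Y : T -> 'rV[R]_d2) :
  0 <= K ->
  (forall x1 x2 y1 y2,
     enorm (F x1 y1 - F x2 y2) <= K * (enorm (x1 - x2) + enorm (y1 - y2))) ->
  L2 X -> L2 Y -> L2 (fun w => F (X w) (Y w)).
Proof.
move=> K0 FK [mX iX] [mY iY].
have mF := measurable_rV_lipschitz K0 FK mX mY.
rewrite (_ : (fun w => _) = (fun w => (F (X w) (Y w) - F 0 0) + F 0 0)); last first.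
  by apply/funext => w; rewrite subrK.
apply: L2D; last exact: L2_cst.
apply: L2_dominated (L1Z (2 * K ^+ 2) (L1D iX iY)) => [|w].
  by apply: measurable_rVB => // j; exact: measurable_cst.
have := FK (X w) 0 (Y w) 0; rewrite !subr0.
have xy0 : 0 <= K * (enorm (X w) + enorm (Y w)).
  by rewrite mulr_ge0 ?addr_ge0 ?enorm_ge0.
rewrite -(ler_pXn2r (ltn0Sn 1)) ?nnegrE ?enorm_ge0// => /le_trans; apply.
rewrite exprMn -[leRHS]mulrA [leRHS]mulrCA ler_wpM2l ?sqr_ge0// sqrrD.
by have := sqr_ge0 (enorm (X w) - enorm (Y w)); rewrite sqrrB; lra.
Qed.

Lemma L1_dotv (n : nat) (X Y : T -> 'rV[R]_n) :
  L2 X -> L2 Y -> L1 (fun w => dotv (X w) (Y w)).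
Proof.
move=> [mX iX] [mY iY]; apply: L1_dominated (L1D iX iY) => [|w].
  exact: measurable_dotv.
apply: le_trans (normr_dotv _ _) _.
have := sqr_ge0 (enorm (X w) - enorm (Y w)); rewrite sqrrB.
have := sqr_ge0 (enorm (X w)); have := sqr_ge0 (enorm (Y w)); lra.
Qed.

Lemma Rintegral_dotv_centered (G : set (set T)) (n : nat)
    (X M : T -> 'rV[R]_n) :
  <<s G >> `<=` measurable ->
  measurable_rV (X : g_sigma_algebraType G -> 'rV[R]_n) ->
  cond_centered P <<s G >> M -> L2 X -> L2 M ->
  \int[P]_w (dotv (X w) (M w)) = 0.
Proof.
move=> sG mX cM [mX' iX] [mM iM]; rewrite /Rintegral.
have iXM (j : 'I_n) : P.-integrable setT (fun w => (X w 0 j * M w 0 j)%:E).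
  apply: (@L1_dominated (fun w => X w 0 j * M w 0 j) _ _ _ (L1D iX iM)) => [|w].
    exact: measurable_funM.
  have hx := coord_le_enorm (X w) j; have hm := coord_le_enorm (M w) j.
  rewrite normrM; apply: le_trans (ler_pM _ _ hx hm) _ => //.
  have := sqr_ge0 (enorm (X w) - enorm (M w)); rewrite sqrrB.
  have := sqr_ge0 (enorm (X w)); have := sqr_ge0 (enorm (M w)); lra.
under eq_integral do rewrite /dotv -sumEFin.
rewrite integral_sum// big1// => j _.
exact: (integral_mul_centered sG (cM j) (mX j) (iXM j)).
Qed.

(** The whole space belongs to the sub-sigma-algebra, so X and its conditional expectation have the
    same integral. *)
Lemma cond_exp_le_Rintegral (G : set (set T)) (X : T -> R) (c : R) :
  cond_exp_le P <<s G >> X c -> L1 X /\ \int[P]_w X w <= c.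
Proof.
move=> [Y [[iX iY _ XY] Yc]]; split => //; rewrite /Rintegral.
have <- := XY setT (@measurableT _ (g_sigma_algebraType G)).
rewrite -lee_fin fineK; last exact: integrable_fin_num.
have mY : measurable_fun setT Y by apply/measurable_EFinP; exact: measurable_int iY.
(* The bound on [Y] holds only almost everywhere; truncating at [c] gives an almost everywhere equal
   function bounded everywhere. *)
have mYc : measurable_fun setT (fun w => Num.min (Y w) c).
  by apply: measurable_minr => //; exact: measurable_cst.
have iYc : L1 (fun w => Num.min (Y w) c).
  apply: L1_dominated (L1D (integrable_abse iY) (L1_cst `|c|)) => // w /=.
  by rewrite /Num.min; case: ifP => _; rewrite ?lerDl ?lerDr.
rewrite (@ae_eq_integral _ _ _ _ _ (fun w => (Num.min (Y w) c)%:E))//; last 3 first.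
- exact/measurable_EFinP.
- exact/measurable_EFinP.
- by apply: filterS Yc => w Yw _; rewrite min_l.
apply: (@le_trans _ _ (\int[P]_w c%:E)%E).
  apply: le_integral => // [|w _]; first exact: L1_cst.
  by rewrite lee_fin ge_min lexx orbT.
by rewrite integral_cst//= probability_setT mule1.
Qed.

End SquareIntegrable.

(** * Harmonic sums and power-law step sizes *)

Lemma harmonic_le_ln (R : realType) (k : nat) :
  \sum_(i < k.+1) (i.+1%:R)^-1 <= 1 + ln k.+1%:R :> R.
Proof.
elim: k => [|k ih]; first by rewrite big_ord1 ln1 invr1 addr0.
rewrite big_ord_recr/=; set t : R := k.+2%:R.
have t0 : 0 < t by rewrite ltr0n.
have tE : k.+1%:R = t * (1 + - t^-1).
  by rewrite mulrDr mulr1 mulrN divff ?gt_eqF// /t -[k.+2]addn1 natrD addrK.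
have h : -1 < - t^-1 by rewrite ltrN2 invf_lt1// ltr1n.
(* With t = k + 2, ln (1 - 1/t) <= - 1/t says that the new term 1/t is at most ln t - ln (t - 1). *)
have := le_ln1Dx h; move: ih; rewrite tE lnM ?posrE//.
  move=> h1 h2; apply: (@le_trans _ _ (1 + (ln t + ln (1 - t^-1)) + t^-1)).
    by rewrite lerD2r.
  by move: h2; set p := ln (1 - _); set q := t^-1; lra.
by rewrite subr_gt0 invf_lt1// ltr1n.
Qed.

Section StepSizes.
Context {R : realType}.
Variables (alpha beta K1 a b : R).
Hypotheses (alpha_gt0 : 0 < alpha) (beta_gt0 : 0 < beta) (K1_ge1 : 1 <= K1).
Hypotheses (a_lt_b : a < b) (b_lt1 : b < 1) (b_gt0 : 0 < b).
Hypothesis step_mul : forall k : nat,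
  stepsize beta K1 b k * stepsize alpha K1 a k <= beta * alpha / (k%:R + K1).

Let t (k : nat) : R := k%:R + K1.
Let t_ge1 k : 1 <= t k. Proof. by rewrite /t -[leLHS]add0r lerD. Qed.
Let t_gt0 k : 0 < t k. Proof. exact: lt_le_trans (t_ge1 k). Qed.

Lemma stepsize_gt0 (c e : R) (k : nat) : 0 < c -> 0 < stepsize c K1 e k.
Proof. by move=> c0; rewrite divr_gt0// powR_gt0// t_gt0. Qed.

(** Cancelling beta alpha in the product condition leaves t^-(a+b) <= t^-1, which decides the
    exponent as soon as t > 1. Index 1 is used because [t 0] is K1, which may equal 1. *)
Let exponents_ge1 : 1 <= a + b.
Proof.
have := step_mul 1; rewrite /stepsize -/(t 1) mulf_div ler_pM2l ?mulr_gt0//.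
rewrite -powRD; last by rewrite (gt_eqF (t_gt0 _)) implybT.
rewrite lef_pV2 ?posrE ?powR_gt0// addrC leNgt => h.
rewrite leNgt; apply: contra h => ab.
have r0 : 0 < 1 - (a + b) by rewrite subr_gt0.
have t1 : 1 < t 1 by rewrite /t (le_lt_trans K1_ge1)// ltrDr.
have := gt0_ltr_powR r0 (x := 1) (y := t 1).
rewrite !nnegrE (ltW (t_gt0 1)) ler01 => /(_ isT isT t1).
rewrite powR1 powRB; last by rewrite (gt_eqF (t_gt0 _)) implybT.
rewrite powRr1 ?ltW//.
by rewrite ltr_pdivlMr ?powR_gt0// mul1r.
Qed.

Let a_gt0 : 0 < a.
Proof. by have := exponents_ge1; have := b_lt1; lra. Qed.

Lemma stepsize_le_init (k : nat) : stepsize alpha K1 a k <= alpha.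
Proof.
rewrite /stepsize -/(t k) ler_pdivrMr ?powR_gt0// ler_peMr ?(ltW alpha_gt0)//.
by rewrite -[leLHS](powRr0 (t k)) ler_powR// ltW.
Qed.

(** The ratio is (beta / alpha) t^-(b - a), and a < b. *)
Lemma stepsize_ratio_le (k : nat) :
  stepsize beta K1 b k.+1 / stepsize alpha K1 a k.+1
    <= stepsize beta K1 b k / stepsize alpha K1 a k.
Proof.
have ratio i : stepsize beta K1 b i / stepsize alpha K1 a i
    = beta / alpha / (t i `^ (b - a)).
  rewrite powRB; last by rewrite (gt_eqF (t_gt0 _)) implybT.
  by rewrite /stepsize -/(t i); field; rewrite !gt_eqF ?powR_gt0.
rewrite !ratio ler_pM2l ?divr_gt0// lef_pV2 ?posrE ?powR_gt0//.
apply: ge0_ler_powR; rewrite ?nnegrE ?(ltW (t_gt0 _))//; first by rewrite subr_ge0 ltW.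
by rewrite /t lerD2r ler_nat.
Qed.

Lemma stepsize_mul_le (k : nat) :
  stepsize beta K1 b k * stepsize alpha K1 a k <= beta * alpha * (k.+1%:R)^-1.
Proof.
apply: le_trans (step_mul k) _; rewrite ler_pM2l ?mulr_gt0//.
by rewrite lef_pV2 ?posrE// ?t_gt0// -natr1 lerD2l.
Qed.

(** For i <= k one has i + K1 <= K1 (k + 1), so each of the k + 1 terms is at least beta / (K1 (k +
    1))^b. *)
Lemma sum_stepsize_ge (k : nat) :
  beta / K1 `^ b * k.+1%:R `^ (1 - b) <= \sum_(i < k.+1) stepsize beta K1 b i.
Proof.
have K1_gt0 : 0 < K1 by exact: lt_le_trans K1_ge1.
have k0 : 0 < k.+1%:R :> R by rewrite ltr0n.
have lb (i : 'I_k.+1) :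
    beta / K1 `^ b / k.+1%:R `^ b <= stepsize beta K1 b i.
  rewrite /stepsize -/(t i) -mulrA -invfM -powRM ?(ltW K1_gt0) ?(ltW k0)// ler_pM2l//.
  rewrite lef_pV2 ?posrE ?powR_gt0 ?mulr_gt0//.
  apply: ge0_ler_powR; rewrite ?nnegrE ?(ltW (t_gt0 _))//; first exact: ltW.
    by rewrite mulr_ge0// ltW.
  apply: (@le_trans _ _ (k%:R + K1)); first by rewrite lerD2r ler_nat -ltnS.
  by rewrite -natr1 mulrDr mulr1 lerD2r ler_peMl.
apply: (@le_trans _ _ (\sum_(i < k.+1) beta / K1 `^ b / k.+1%:R `^ b)).
  rewrite sumr_const card_ord -[leRHS]mulr_natr powRB; last by rewrite pnatr_eq0 implybT.
  by rewrite powRr1 ?(ltW k0)// mulrA mulrAC.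
by apply: ler_sum => i _; exact: lb.
Qed.

End StepSizes.

(** * The filtration generated by the noise *)

Section NoiseFiltration.
Context {R : realType} d (T : measurableType d) (P : probability T R).
Context {d1 d2 : nat}.
Variables (M : nat -> T -> 'rV[R]_d1) (M' : nat -> T -> 'rV[R]_d2).

(** The generators of [noise_filtration], named so that [g_sigma_algebraType] can be formed from
    them. *)
Definition noise_events (k : nat) : set (set T) :=
  [set A | exists i : nat, (0 < i <= k)%N /\
     (coord_events (M i) A \/ coord_events (M' i) A)].

Local Notation TF k := (g_sigma_algebraType (noise_events k)).

Lemma noise_events_sub (k : nat) (M_meas : forall i, measurable_rV (M i.+1))
    (M'_meas : forall i, measurable_rV (M' i.+1)) :
  <<s noise_events k >> `<=` measurable.
Proof.
apply: smallest_sub; first exact: sigma_algebra_measurable.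
move=> A [i [/andP[i0 _] h]]; case: i i0 h => // i _.
case=> -[j [B [mB ->]]]; rewrite -[X in measurable X]setTI.
  exact: (M_meas i j measurableT B mB).
exact: (M'_meas i j measurableT B mB).
Qed.

Lemma noise_events_mono (k : nat) :
  <<s noise_events k >> `<=` <<s noise_events k.+1 >>.
Proof.
apply: sub_sigma_algebra2 => A [i [/andP[i0 ik] h]].
by exists i; rewrite i0 leqW.
Qed.

Lemma adapted_next (k n : nat) (X : T -> 'rV[R]_n) :
  measurable_rV (X : TF k -> 'rV[R]_n) -> measurable_rV (X : TF k.+1 -> 'rV[R]_n).
Proof. by move=> mX j _ B mB; apply: noise_events_mono; exact: mX. Qed.

Lemma noise_adapted (k : nat) :
  measurable_rV (M k.+1 : TF k.+1 -> 'rV[R]_d1) /\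
  measurable_rV (M' k.+1 : TF k.+1 -> 'rV[R]_d2).
Proof.
by split=> j _ B mB; rewrite setTI; apply: sub_sigma_algebra;
  exists k.+1; rewrite ltnSn; split => //; [left|right]; exists j, B.
Qed.

End NoiseFiltration.

(** * Decrease of the expected potential along the iterates *)

Section StochasticApproximation.
Context {R : realType} {d1 d2 : nat}.
Variables (f : 'rV[R]_d1 -> 'rV[R]_d2 -> 'rV[R]_d1).
Variables (g : 'rV[R]_d1 -> 'rV[R]_d2 -> 'rV[R]_d2).
Variables (J : 'rV[R]_d2 -> R) (mu Jmin L c2 : R).
Hypotheses (mu_ge0 : 0 <= mu) (mu_lt1 : mu < 1) (L_gt0 : 0 < L).
Hypothesis f_contraction : forall (x1 x2 : 'rV[R]_d1) (y : 'rV[R]_d2),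
  enorm (f x1 y - f x2 y) <= mu * enorm (x1 - x2).
Hypothesis J_diff : forall y, differentiable J y.
Hypothesis g_gradient : forall y : 'rV[R]_d2, g (fixpt f y) y - y = - grad J y.
Hypothesis J_bounded_below : forall y : 'rV[R]_d2, Jmin <= J y.
Hypothesis f_lipschitz : forall (x1 x2 : 'rV[R]_d1) (y1 y2 : 'rV[R]_d2),
  enorm (f x1 y1 - f x2 y2) <= L * (enorm (x1 - x2) + enorm (y1 - y2)).
Hypothesis G_lipschitz : forall (x1 x2 : 'rV[R]_d1) (y1 y2 : 'rV[R]_d2),
  enorm ((g x1 y1 - y1) - (g x2 y2 - y2))
    <= L * (enorm (x1 - x2) + enorm (y1 - y2)).

Local Notation kap := (lyap_weight mu L).
Local Notation Q := (increment_weight mu L).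

Variables (al be : nat -> R).
Hypotheses (al_in01 : forall k, 0 < al k <= 1) (be_gt0 : forall k, 0 < be k).
Hypothesis be_al : forall k, be k ^+ 2 <= al k ^+ 3.
Hypothesis al_small : forall k, al k * (8 * Q) <= 1.
Hypothesis ratio_le : forall k, be k.+1 / al k.+1 <= be k / al k.

Variables (x0 : 'rV[R]_d1) (y0 : 'rV[R]_d2).
Context d (T : measurableType d) (P : probability T R).
Variables (M : nat -> T -> 'rV[R]_d1) (M' : nat -> T -> 'rV[R]_d2).
Variables (x : nat -> T -> 'rV[R]_d1) (y : nat -> T -> 'rV[R]_d2).
Hypothesis M_centered : forall k,
  cond_centered P (noise_filtration M M' k) (M k.+1).
Hypothesis M'_centered : forall k,
  cond_centered P (noise_filtration M M' k) (M' k.+1).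
Hypothesis noise_le : forall k, cond_exp_le P (noise_filtration M M' k)
  (fun w => enorm (M k.+1 w) ^+ 2 + enorm (M' k.+1 w) ^+ 2) c2.
Hypotheses (x_init : forall w, x 0%N w = x0) (y_init : forall w, y 0%N w = y0).
Hypothesis x_next : forall k w,
  x k.+1 w = x k w + al k *: (f (x k w) (y k w) - x k w + M k.+1 w).
Hypothesis y_next : forall k w,
  y k.+1 w = y k w + be k *: (g (x k w) (y k w) - y k w + M' k.+1 w).

Local Notation TF k := (g_sigma_algebraType (noise_events M M' k)).

Let x_nextE k :
  x k.+1 = fun w => x k w + al k *: (f (x k w) (y k w) - x k w + M k.+1 w).
Proof. by apply/funext => w. Qed.

Let y_nextE k :
  y k.+1 = fun w => y k w + be k *: (g (x k w) (y k w) - y k w + M' k.+1 w).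
Proof. by apply/funext => w. Qed.

Let M_meas k : measurable_rV (M k.+1).
Proof.
move=> j; have [iM _ _ _] := M_centered k j.
by apply/measurable_EFinP; exact: measurable_int iM.
Qed.

Let M'_meas k : measurable_rV (M' k.+1).
Proof.
move=> j; have [iM _ _ _] := M'_centered k j.
by apply/measurable_EFinP; exact: measurable_int iM.
Qed.

Let F_sub k : <<s noise_events M M' k >> `<=` measurable.
Proof. exact: noise_events_sub. Qed.

Let L_ge0 : 0 <= L. Proof. exact: ltW. Qed.

Let fixpt_lip_ge0 : 0 <= fixpt_lip mu L.
Proof. by rewrite divr_ge0// subr_ge0 ltW. Qed.

Let f_lip_y (u : 'rV[R]_d1) (y1 y2 : 'rV[R]_d2) :
  enorm (f u y1 - f u y2) <= L * enorm (y1 - y2).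
Proof.
by apply: le_trans (f_lipschitz _ _ _ _) _; rewrite subrr enorm0 add0r.
Qed.

(** Stated with two vector arguments to match [L2_lipschitz] and [measurable_rV_lipschitz]. *)
Let fixpt_lipschitz2 (x1 x2 : 'rV[R]_d1) (y1 y2 : 'rV[R]_d2) :
  enorm (fixpt f y1 - fixpt f y2)
    <= fixpt_lip mu L * (enorm (x1 - x2) + enorm (y1 - y2)).
Proof.
apply: le_trans (fixpt_lipschitz mu_ge0 mu_lt1 f_contraction f_lip_y _ _) _.
by rewrite ler_wpM2l// lerDr enorm_ge0.
Qed.

Let grad_lip_ge0 : 0 <= grad_lip mu L.
Proof. by rewrite mulr_ge0// addr_ge0. Qed.

Let gradJ_lipschitz := grad_lipschitz mu_ge0 mu_lt1 L_gt0
  f_contraction f_lip_y g_gradient G_lipschitz.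

Let gradJ_lipschitz2 (x1 x2 : 'rV[R]_d1) (y1 y2 : 'rV[R]_d2) :
  enorm (grad J y1 - grad J y2)
    <= grad_lip mu L * (enorm (x1 - x2) + enorm (y1 - y2)).
Proof.
apply: le_trans (gradJ_lipschitz _ _) _.
by rewrite ler_wpM2l// lerDr enorm_ge0.
Qed.

Let adapted k : measurable_rV (x k : TF k -> 'rV[R]_d1) /\
                measurable_rV (y k : TF k -> 'rV[R]_d2).
Proof.
elim: k => [|k [mx my]].
  by split => j; [under eq_fun do rewrite x_init|under eq_fun do rewrite y_init];
    exact: measurable_cst.
have {}mx := adapted_next mx; have {}my := adapted_next my.
have [mM mM'] := noise_adapted M M' k.
rewrite x_nextE y_nextE.
split; apply: measurable_rVD => //; apply: measurable_rVZ; apply: measurable_rVD => //.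
  by apply: measurable_rVB => //; exact: measurable_rV_lipschitz f_lipschitz _ _.
exact: measurable_rV_lipschitz G_lipschitz _ _.
Qed.

Let noise_L1 k : L1 P (fun w => enorm (M k.+1 w) ^+ 2 + enorm (M' k.+1 w) ^+ 2).
Proof. by have [] := cond_exp_le_Rintegral (noise_le k). Qed.

Let M_L2 k : L2 P (M k.+1).
Proof.
by apply: L2_dominated (noise_L1 k) => // w; rewrite lerDl sqr_ge0.
Qed.

Let M'_L2 k : L2 P (M' k.+1).
Proof.
by apply: L2_dominated (noise_L1 k) => // w; rewrite lerDr sqr_ge0.
Qed.

Let iterates_L2 k : L2 P (x k) /\ L2 P (y k).
Proof.
elim: k => [|k [Lx Ly]].
  rewrite (_ : x 0 = cst x0); last by apply/funext => w; exact: x_init.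
  rewrite (_ : y 0 = cst y0); last by apply/funext => w; exact: y_init.
  by split; exact: L2_cst.
rewrite x_nextE y_nextE.
split; apply: L2D => //; apply: L2Z; apply: L2D => //.
  by apply: L2B => //; exact: L2_lipschitz f_lipschitz _ _.
exact: L2_lipschitz G_lipschitz _ _.
Qed.

Lemma grad_L2 k : L2 P (fun w => grad J (y k w)).
Proof.
have [Lx Ly] := iterates_L2 k.
exact: (L2_lipschitz grad_lip_ge0 gradJ_lipschitz2 Lx Ly).
Qed.

Let grad_adapted k : measurable_rV ((fun w => grad J (y k w)) : TF k -> 'rV[R]_d2).
Proof.
have [mx my] := adapted k.
exact: (measurable_rV_lipschitz grad_lip_ge0 gradJ_lipschitz2 mx my).
Qed.

Let fixpt_L2 k : L2 P (fun w => fixpt f (y k w)).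
Proof.
have [Lx Ly] := iterates_L2 k.
exact: (L2_lipschitz fixpt_lip_ge0 fixpt_lipschitz2 Lx Ly).
Qed.

Let fixpt_adapted k :
  measurable_rV ((fun w => fixpt f (y k w)) : TF k -> 'rV[R]_d1).
Proof.
have [mx my] := adapted k.
exact: (measurable_rV_lipschitz fixpt_lip_ge0 fixpt_lipschitz2 mx my).
Qed.

Let mean_L2 k : L2 P (fun w => tracking_mean f (al k) (x k w) (y k w)).
Proof.
have [Lx Ly] := iterates_L2 k; apply: L2D; first exact: L2B.
by apply: L2Z; apply: L2B => //; exact: L2_lipschitz f_lipschitz _ _.
Qed.

Let mean_adapted k : measurable_rV
  ((fun w => tracking_mean f (al k) (x k w) (y k w)) : TF k -> 'rV[R]_d1).
Proof.
have [mx my] := adapted k; apply: measurable_rVD; first exact: measurable_rVB.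
apply: measurable_rVZ; apply: measurable_rVB => //.
exact: measurable_rV_lipschitz f_lipschitz _ _.
Qed.

(** J(y_k) is squeezed between Jmin and the quadratic bound given by [descent] at the origin, which
    is integrable because y_k is square integrable. *)
Let J_L1 k : L1 P (fun w => J (y k w)).
Proof.
have [_ [my iy]] := iterates_L2 k.
have iB := L1D (L1D (L1_cst P (`|J 0| + `|Jmin|))
    (L1_dotv (L2_cst P (grad J 0)) (conj my iy)))
  (L1Z (grad_lip mu L) iy).
have iB' := L1D (L1_cst P (`|Jmin|)) (integrable_abse iB).
apply: L1_dominated iB' => [|w /=].
  by apply: measurable_continuous_rV => // u; exact: differentiable_continuous.
have := descent J_diff gradJ_lipschitz grad_lip_ge0 0 (y k w); rewrite add0r.
set B := grad_lip mu L * _; set D := dotv _ _ => hJ.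
have hl := J_bounded_below (y k w).
have := ler_norm (`|J 0| + `|Jmin| + D + B); have := ler_norm (J 0).
have := ler_norm (- Jmin); rewrite normrN.
have := normr_ge0 (`|J 0| + `|Jmin| + D + B); have := normr_ge0 Jmin.
by move=> ? ? ? ? ?; rewrite ler_norml; apply/andP; split; lra.
Qed.

Let tracking_L1 k : L1 P (fun w => enorm (x k w - fixpt f (y k w)) ^+ 2).
Proof. by have [Lx _] := iterates_L2 k; case: (L2B Lx (fixpt_L2 k)). Qed.

Definition mean_lyapunov k : R :=
  \int[P]_w (J (y k w) + kap * (be k / al k) * enorm (x k w - fixpt f (y k w)) ^+ 2).

(** Integrating [lyapunov_step]: both noise products pair an adapted vector with a centered one and
    vanish, and the noise energy is at most c2 in mean. *)
Lemma mean_lyapunov_step k :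
  mean_lyapunov k.+1 <= mean_lyapunov k
    - be k / 4 * \int[P]_w (enorm (grad J (y k w)) ^+ 2)
    + (Q + 2 * kap) * (be k * al k) * c2.
Proof.
pose V w := J (y k w) + kap * (be k / al k) * enorm (x k w - fixpt f (y k w)) ^+ 2.
pose D w := enorm (grad J (y k w)) ^+ 2.
pose S w := dotv (grad J (y k w)) (M' k.+1 w).
pose S' w := dotv (tracking_mean f (al k) (x k w) (y k w)) (M k.+1 w).
pose N w := enorm (M k.+1 w) ^+ 2 + enorm (M' k.+1 w) ^+ 2.
pose r := 2 * kap * be k * (1 + (1 - mu) * al k).
have kap_ge0 : 0 <= kap by rewrite divr_ge0 ?sqr_ge0// subr_ge0 ltW.
have C_ge0 : 0 <= (Q + 2 * kap) * (be k * al k).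
  have al0 : 0 <= al k by case/andP: (al_in01 k) => /ltW.
  have Q0 : 0 <= Q.
    apply: addr_ge0; first exact: mulr_ge0.
    apply: mulr_ge0; last by rewrite invr_ge0 subr_ge0 ltW.
    by apply: mulr_ge0; [exact: mulr_ge0|exact: sqr_ge0].
  apply: mulr_ge0; first by rewrite addr_ge0// mulr_ge0.
  by rewrite mulr_ge0// ltW.
have V_L1 : L1 P V by apply: L1D => //; exact: L1Z.
have D_L1 : L1 P D by case: (grad_L2 k).
have S_L1 : L1 P S by apply: L1_dotv => //; exact: grad_L2.
have S'_L1 : L1 P S' by apply: L1_dotv.
have N_L1 : L1 P N by exact: noise_L1.
have S0 : \int[P]_w S w = 0.
  exact: (Rintegral_dotv_centered (@F_sub k) (@grad_adapted k) (@M'_centered k)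
    (grad_L2 k) (M'_L2 k)).
have S'0 : \int[P]_w S' w = 0.
  exact: (Rintegral_dotv_centered (@F_sub k) (@mean_adapted k) (@M_centered k)
    (mean_L2 k) (M_L2 k)).
have N_le : \int[P]_w N w <= c2 by have [] := cond_exp_le_Rintegral (noise_le k).
pose U w := V w - be k / 4 * D w + be k * S w + r * S' w
            + (Q + 2 * kap) * (be k * al k) * N w.
have U1 : L1 P (fun w => V w - be k / 4 * D w) by apply: L1B => //; exact: L1Z.
have U2 : L1 P (fun w => V w - be k / 4 * D w + be k * S w).
  by apply: L1D => //; exact: L1Z.
have U3 : L1 P (fun w => V w - be k / 4 * D w + be k * S w + r * S' w).
  by apply: L1D => //; exact: L1Z.
have U_L1 : L1 P U by apply: L1D => //; exact: L1Z.
have -> : mean_lyapunov k = \int[P]_w V w by [].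
apply: (@le_trans _ _ (\int[P]_w U w)).
  apply: le_Rintegral => // [|w _].
    by apply: L1D => //; exact: L1Z.
  apply: le_trans (lyapunov_step mu_ge0 mu_lt1 L_gt0 f_contraction f_lip_y
    g_gradient G_lipschitz J_diff (x k w) (M k.+1 w) (y k w) (M' k.+1 w)
    (al_in01 k) (be_gt0 k) (be_al k) (al_small k)).
  (* [lyapunov_step] weights the new tracking error by be k / al k; monotonicity of the ratio
     permits the weight of index k + 1. *)
  rewrite -x_next -y_next lerD2l ler_wpM2r ?sqr_ge0// ler_wpM2l//.
rewrite /U RintegralD//; last exact: L1Z.
rewrite RintegralD//; last exact: L1Z.
rewrite RintegralD//; last exact: L1Z.
rewrite RintegralB//; last exact: L1Z.
rewrite !RintegralZl// S0 S'0 !mulr0 !addr0 lerD2l.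
by rewrite ler_wpM2l.
Qed.

Lemma mean_lyapunov_ge k : Jmin <= mean_lyapunov k.
Proof.
have -> : Jmin = \int[P]_w cst Jmin w.
  by rewrite Rintegral_cst//= probability_setT mulr1.
apply: le_Rintegral => // [||w _].
- exact: L1_cst.
- by apply: L1D => //; exact: L1Z.
- apply: le_trans (J_bounded_below (y k w)) _; rewrite lerDl mulr_ge0 ?sqr_ge0//.
  have /andP[al0 _] := al_in01 k.
  by rewrite mulr_ge0 ?divr_ge0 ?sqr_ge0 ?subr_ge0//; exact: ltW.
Qed.

Lemma mean_lyapunov0 : mean_lyapunov 0 =
  J y0 + kap * (be 0%N / al 0%N) * enorm (x0 - fixpt f y0) ^+ 2.
Proof.
rewrite /mean_lyapunov; under eq_Rintegral do rewrite x_init y_init.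
by rewrite Rintegral_cst//= probability_setT mulr1.
Qed.

Lemma sum_grad_le k :
  \sum_(i < k) be i * \int[P]_w (enorm (grad J (y i w)) ^+ 2)
    <= 4 * (mean_lyapunov 0 - Jmin
       + (Q + 2 * kap) * c2 * \sum_(i < k) be i * al i).
Proof.
(* The last potential stays on the left so that the sum telescopes; it is replaced by Jmin only at
   the end. *)
suff h : mean_lyapunov k
    + 4^-1 * \sum_(i < k) be i * \int[P]_w (enorm (grad J (y i w)) ^+ 2)
    <= mean_lyapunov 0 + (Q + 2 * kap) * c2 * \sum_(i < k) be i * al i.
  rewrite -ler_pdivrMl//; move: h; rewrite -lerBrDl => /le_trans; apply.
  by rewrite [leLHS]addrAC lerD2r lerD2l lerN2 mean_lyapunov_ge.
elim: k => [|k ih]; first by rewrite !big_ord0 !mulr0 !addr0.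
rewrite !big_ord_recr/=; apply: le_trans (lerD (mean_lyapunov_step k) (lexx _)) _.
set S := \sum_(i < k) be i * Rintegral _ _ _ in ih *; set e := Rintegral _ _ _.
rewrite [leLHS](_ : _ = mean_lyapunov k + 4^-1 * S
  + (Q + 2 * kap) * c2 * (be k * al k)); last by field.
by rewrite [in leRHS]mulrDr addrA lerD2r.
Qed.

End StochasticApproximation.

(** * From the weighted sum to the minimum, and the rate *)

(** If every [E i] exceeded [B], the weighted sum would be at least [B] times the total weight,
    against the strict bound on [N]. *)
Lemma exists_le_weighted_sum (R : realDomainType) (n : nat) (w E : nat -> R)
    (B N : R) :
  (forall i, 0 <= w i) -> \sum_(i < n) w i * E i <= N ->
  N < B * \sum_(i < n) w i -> exists i : 'I_n, E i <= B.
Proof.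
move=> w0 hN NB; apply: contrapT => h.
have : B * \sum_(i < n) w i <= N.
  apply: le_trans hN; rewrite mulr_sumr; apply: ler_sum => i _.
  rewrite mulrC ler_wpM2l// leNgt; apply/negP => /ltW Ei; apply: h; by exists i.
by rewrite leNgt NB.
Qed.

(** The order of quantifiers encodes the dependence of the constants: [C4] precedes the step-size
    parameters, and [C3] follows them and the initial points but precedes the probability space. The
    minimum lives in the extended reals, with neutral element [+oo]. *)
Theorem theorem4p3 (R : realType) (d1 d2 : nat)
  (f : 'rV[R]_d1 -> 'rV[R]_d2 -> 'rV[R]_d1)
  (g : 'rV[R]_d1 -> 'rV[R]_d2 -> 'rV[R]_d2)
  (J : 'rV[R]_d2 -> R) (mu Jmin L c2 : R)
  (mu_ge0 : 0 <= mu) (mu_lt1 : mu < 1)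
  (f_contraction : forall (x1 x2 : 'rV[R]_d1) (y : 'rV[R]_d2),
     enorm (f x1 y - f x2 y) <= mu * enorm (x1 - x2))
  (J_differentiable : forall y : 'rV[R]_d2, differentiable J y)
  (g_gradient : forall y : 'rV[R]_d2, g (fixpt f y) y - y = - grad J y)
  (J_bounded_below : forall y : 'rV[R]_d2, Jmin <= J y)
  (L_gt0 : 0 < L)
  (fg_lipschitz : forall (x1 x2 : 'rV[R]_d1) (y1 y2 : 'rV[R]_d2),
     enorm (f x1 y1 - f x2 y2) + enorm (g x1 y1 - g x2 y2)
       <= L * (enorm (x1 - x2) + enorm (y1 - y2)))
  (G_lipschitz : forall (x1 x2 : 'rV[R]_d1) (y1 y2 : 'rV[R]_d2),
     enorm ((g x1 y1 - y1) - (g x2 y2 - y2))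
       <= L * (enorm (x1 - x2) + enorm (y1 - y2)))
  (c2_gt0 : 0 < c2) :
  exists C4 : R, 0 < C4 /\
  forall alpha beta K1 a b : R,
    0 < alpha -> 0 < beta -> 1 <= K1 -> a < b -> b < 1 -> 2^-1 < b ->
    (forall k : nat,
       stepsize beta K1 b k ^+ 2 <= stepsize alpha K1 a k ^+ 3) ->
    (forall k : nat,
       stepsize beta K1 b k * stepsize alpha K1 a k
         <= beta * alpha / (k%:R + K1)) ->
  forall (x0 : 'rV[R]_d1) (y0 : 'rV[R]_d2),
  exists C3 : R, 0 < C3 /\
  (alpha <= C4 ->
   forall (d : measure_display) (T : measurableType d) (P : probability T R)
     (M : nat -> T -> 'rV[R]_d1) (M' : nat -> T -> 'rV[R]_d2)
     (x : nat -> T -> 'rV[R]_d1) (y : nat -> T -> 'rV[R]_d2),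
     (forall k : nat,
        cond_centered P (noise_filtration M M' k) (M k.+1)) ->
     (forall k : nat,
        cond_centered P (noise_filtration M M' k) (M' k.+1)) ->
     (forall k : nat,
        cond_exp_le P (noise_filtration M M' k)
          (fun w => enorm (M k.+1 w) ^+ 2 + enorm (M' k.+1 w) ^+ 2) c2) ->
     (forall w : T, x 0%N w = x0) ->
     (forall w : T, y 0%N w = y0) ->
     (forall (k : nat) (w : T),
        x k.+1 w = x k w + stepsize alpha K1 a k *:
                     (f (x k w) (y k w) - x k w + M k.+1 w)) ->
     (forall (k : nat) (w : T),
        y k.+1 w = y k w + stepsize beta K1 b k *:
                     (g (x k w) (y k w) - y k w + M' k.+1 w)) ->
     forall k : nat,
       (\big[Order.min/+oo]_(i < k.+1)
            'E_P[fun w => (enorm (grad J (y i w)) ^+ 2)%R]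
          <= (C3 * (1 + ln k.+1%:R) / k.+1%:R `^ (1 - b))%:E)%E).
Proof.
pose kap := lyap_weight mu L; pose Q := increment_weight mu L.
have c0 : 0 < 1 - mu by rewrite subr_gt0.
have lip_gt0 : 0 < fixpt_lip mu L by exact: divr_gt0.
have kap_gt0 : 0 < kap by apply: divr_gt0 => //; exact: exprn_gt0.
have Q_gt0 : 0 < Q.
  apply: addr_gt0; first by rewrite !mulr_gt0// addr_gt0.
  by apply: divr_gt0 => //; apply: mulr_gt0; [exact: mulr_gt0|exact: exprn_gt0].
have Q8_gt0 : 0 < 8 * Q by exact: mulr_gt0.
(* The bound 1 gives al k <= 1; the bound 1 / (8 Q) lets the gradient decrease absorb the squared
   increment. *)
exists (Num.min 1 (8 * Q)^-1); split; first by rewrite lt_min ltr01 invr_gt0.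
move=> alpha beta K1 a b alpha_gt0 beta_gt0 K1_ge1 a_lt_b b_lt1 b_half sq mul x0 y0.
have b_gt0 : 0 < b by apply: lt_trans b_half; rewrite invr_gt0.
have K1_gt0 : 0 < K1 by exact: lt_le_trans K1_ge1.
pose al := stepsize alpha K1 a; pose be := stepsize beta K1 b.
have al_gt0 k : 0 < al k by exact: stepsize_gt0.
have be_gt0 k : 0 < be k by exact: stepsize_gt0.
pose V0 := J y0 + kap * (be 0%N / al 0%N) * enorm (x0 - fixpt f y0) ^+ 2.
pose C := (Q + 2 * kap) * c2.
have C_gt0 : 0 < C by rewrite mulr_gt0// addr_gt0// mulr_gt0.
have V0_ge : 0 <= V0 - Jmin.
  rewrite subr_ge0 (le_trans (J_bounded_below y0))// lerDl mulr_ge0 ?sqr_ge0//.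
  by rewrite ltW// mulr_gt0// divr_gt0.
pose N := 4 * (V0 - Jmin + C * (beta * alpha)).
have N_gt0 : 0 < N.
  by rewrite mulr_gt0// ltr_wpDl// mulr_gt0// mulr_gt0.
have wK_gt0 : 0 < beta / K1 `^ b by rewrite divr_gt0// powR_gt0.
(* [N] times the logarithmic factor bounds the weighted sum, and the denominator comes from
   [sum_stepsize_ge]. Taking N + 1 makes the comparison [BS] strict. *)
exists ((N + 1) / (beta / K1 `^ b)); split; first by rewrite divr_gt0// addr_gt0.
move=> alpha_le d T P M M' x y cM cM' noise x_init y_init x_next y_next k.
move: alpha_le; rewrite le_min => /andP[alpha_le1 alphaQ].
have al_le k' : al k' <= alpha.
  exact: stepsize_le_init alpha_gt0 beta_gt0 K1_ge1 b_lt1 mul k'.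
have al_in01 k' : 0 < al k' <= 1 by rewrite al_gt0 (le_trans (al_le k')).
have al_small k' : al k' * (8 * Q) <= 1.
  by rewrite -ler_pdivlMr// div1r (le_trans (al_le k')).
have ratio_le k' : be k'.+1 / al k'.+1 <= be k' / al k'.
  exact: stepsize_ratio_le alpha_gt0 beta_gt0 K1_ge1 a_lt_b k'.
have f_lip x1 x2 y1 y2 : enorm (f x1 y1 - f x2 y2)
    <= L * (enorm (x1 - x2) + enorm (y1 - y2)).
  by apply: le_trans (fg_lipschitz _ _ _ _); rewrite lerDl enorm_ge0.
pose E i := \int[P]_w (enorm (grad J (y i w)) ^+ 2).
have EE i : ('E_P[fun w => (enorm (grad J (y i w)) ^+ 2)%R] = (E i)%:E)%E.
  rewrite unlock /E /Rintegral fineK//.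
  have [_] := grad_L2 mu_ge0 mu_lt1 L_gt0 f_contraction g_gradient f_lip
    G_lipschitz cM cM' noise x_init y_init x_next y_next i.
  exact: integrable_fin_num.
have sumE : \sum_(i < k.+1) be i * E i
    <= 4 * (V0 - Jmin + C * \sum_(i < k.+1) be i * al i).
  rewrite /V0 /C -(mean_lyapunov0 f J mu L al be P x_init y_init).
  exact: (sum_grad_le mu_ge0 mu_lt1 L_gt0 f_contraction J_differentiable
    g_gradient J_bounded_below f_lip G_lipschitz al_in01 be_gt0 sq al_small
    ratio_le cM cM' noise x_init y_init x_next y_next k.+1).
pose l : R := 1 + ln k.+1%:R.
have l_ge1 : 1 <= l by rewrite lerDl ln_ge0// ler1n.
have p_gt0 : 0 < k.+1%:R `^ (1 - b) :> R by rewrite powR_gt0// ltr0n.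
have sumN : \sum_(i < k.+1) be i * E i <= N * l.
  apply: le_trans sumE _; rewrite /N -mulrA ler_pM2l// mulrDl lerD//.
    (* The initial gap V0 - Jmin is absorbed because l >= 1. *)
    by rewrite ler_peMr.
  rewrite -mulrA ler_pM2l//.
  apply: (@le_trans _ _ (\sum_(i < k.+1) beta * alpha * (i.+1%:R)^-1)).
    apply: ler_sum => i _; exact: stepsize_mul_le alpha_gt0 beta_gt0 K1_ge1 mul i.
  by rewrite -mulr_sumr ler_pM2l ?mulr_gt0// harmonic_le_ln.
pose B := (N + 1) / (beta / K1 `^ b) * l / k.+1%:R `^ (1 - b).
have BS : N * l < B * \sum_(i < k.+1) be i.
  have B_gt0 : 0 < B.
    apply: divr_gt0 => //; apply: mulr_gt0; last exact: lt_le_trans ltr01 l_ge1.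
    by apply: divr_gt0 => //; exact: addr_gt0.
  apply: (@lt_le_trans _ _ (B * (beta / K1 `^ b * k.+1%:R `^ (1 - b)))).
    rewrite [ltRHS](_ : _ = (N + 1) * l); last first.
      by rewrite /B; field; rewrite !gt_eqF ?powR_gt0.
    by rewrite ltr_pM2r ?ltrDl// (lt_le_trans ltr01).
  by rewrite ler_pM2l//; exact: sum_stepsize_ge.
have [i Ei] := exists_le_weighted_sum (fun i => ltW (be_gt0 i)) sumN BS.
apply: (@le_trans _ _ (E i)%:E); last by rewrite lee_fin.
by rewrite -EE; exact: bigmin_le.
Qed.
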